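(* Let $n,k$ be positive integers with $\frac{n}{\log n}\leqslant k\leqslant\frac{2n}{\log n+6}$ (equivalently $\frac{1}{\log n}\leqslant\lambda\leqslant\frac{2}{e^3}\cdot\frac{\sqrt n}{\log n+6}$), and put $\rho=n/k$. Then for every fixed integer $N\geqslant 0$, \[ S(n,k)=\sum_{0\leqslant j\leqslant k}(-1)^j\binom{k}{j}\left(1-\frac1k\right)^{nj}\left(\sum_{0\leqslant m\leqslant N}\frac{c_m(\rho,j)}{k^m}\right)+R_N(n,k), \] where \[ R_N(n,k)=O\left(\left(1-\frac{\lambda}{k}\right)^k\left(\frac{\lambda\log n}{\sqrt n}\right)^{2N+1}\right), \] with implied constant depending only on $N$.
   Context: $S(n,k):=\left\{ n \atop k\right\}\frac{k!}{k^n}=\sum_{0\leqslant j\leqslant k}\binom{k}{j}(-1)^j\left(1-\frac jk\right)^n$, where $\left\{ n \atop k\right\}$ is the Stirling number of the second kind; $\lambda:=ke^{-n/k}$. The polynomials $c_m(w,j)$ (in $w$ and $j$) are defined by the power series expansion in $t$ \[ \frac{(1-jt)^{w/t}}{(1-t)^{jw/t}}=\sum_{m\geqslant 0}c_m(w,j)\,t^m, \] equivalently the left side equals $\exp\bigl(-wj\sum_{r\geqslant 1}\frac{j^r-1}{r+1}t^r\bigr)$. $\log$ is natural. *)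

(* Defs.v *)
From HB Require Import structures.
From mathcomp Require Import all_boot all_order all_algebra.
From mathcomp Require Import all_classical all_reals all_analysis.
From mathcomp Require Import ring lra.

Set Implicit Arguments.
Unset Strict Implicit.
Unset Printing Implicit Defensive.

Import Order.TTheory GRing.Theory Num.Theory.
Import numFieldNormedType.Exports.

Local Open Scope ring_scope.

(* Stirling number of the second kind: the number of partitions of an
   n-element set into k nonempty blocks. *)
Definition stirling2 (n k : nat) : nat :=
  #|[set P : {set {set 'I_n}} | finset.partition P [set: 'I_n] && (#|P| == k)]%SET|.

Definition Snk (R : realType) (n k : nat) : R :=
  (stirling2 n k)%:R * k`!%:R / k%:R ^+ n.

Definition lambda (R : realType) (n k : nat) : R :=
  k%:R * expR (- (n%:R / k%:R)).

(* Formally, log ((1 - j t)^(w/t) / (1 - t)^(j w/t))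
     = - w j \sum_(r >= 1) (j^r - 1) / (r + 1) t^r;
   this is the truncation of that series to degree d (the r = 0 term is 0). *)
Definition clog (R : realType) (w j : R) (d : nat) : {poly R} :=
  \poly_(r < d.+1) (- (w * j * (j ^+ r - 1) / r.+1%:R)).

(* c_m(w, j), the coefficient of t^m in (1 - j t)^(w/t) / (1 - t)^(j w/t).
   It is read off the exponential series of clog; since clog has no constant
   term, the truncations (degree m in t, exponent at most m) do not affect the
   coefficient of t^m. See cpoly_expansion below. *)
Definition cpoly (R : realType) (m : nat) (w j : R) : R :=
  (\sum_(l < m.+1) l`!%:R^-1 *: clog w j m ^+ l)`_m.

Local Open Scope classical_set_scope.

Section Expansion.
Variable R : realType.
Implicit Types (w j t x y : R) (p q : {poly R}).

Lemma clog_coef w j d r : (r <= d)%N ->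
  (clog w j d)`_r = - (w * j * (j ^+ r - 1) / r.+1%:R).
Proof. by move=> rd; rewrite coef_poly ltnS rd. Qed.

Lemma coef_exp_trunc p q l i :
  (forall r, (r <= i)%N -> p`_r = q`_r) -> (p ^+ l)`_i = (q ^+ l)`_i.
Proof.
move=> pq; suff H : forall r, (r <= i)%N -> (p ^+ l)`_r = (q ^+ l)`_r by exact: H.
elim: l => [|l IH] r ri; first by rewrite !expr0.
rewrite !exprS !coefM; apply: eq_bigr => a _.
rewrite pq ?IH//; first exact: leq_trans (leq_subr _ _) ri.
by rewrite (leq_trans _ ri)// -ltnS.
Qed.

Lemma coef_exp_lt p l i : p`_0 = 0 -> (i < l)%N -> (p ^+ l)`_i = 0.
Proof.
move=> p0; elim: l i => // l IH i il.
rewrite exprS coefM big1// => -[[|a] /= ai] _; first by rewrite p0 mul0r.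
rewrite IH ?mulr0//; rewrite ltnS in ai.
by case: i il ai => // i il _; rewrite subSS (leq_ltn_trans (leq_subr _ _)).
Qed.

Lemma coef_exp_bound p q l i : (forall r, `|p`_r| <= q`_r) ->
  `|(p ^+ l)`_i| <= (q ^+ l)`_i.
Proof.
move=> pq; elim: l i => [|l IH] i.
  by rewrite !expr0 coef1 normr_nat.
rewrite !exprS !coefM; apply: (le_trans (ler_norm_sum _ _ _)).
by apply: ler_sum => a _; rewrite normrM ler_pM.
Qed.

Definition expp p M : {poly R} := \sum_(l < M.+1) l`!%:R^-1 *: p ^+ l.

Lemma expp_horner p M t :
  (expp p M).[t] = \sum_(l < M.+1) p.[t] ^+ l / l`!%:R.
Proof.
rewrite /expp horner_sum; apply: eq_bigr => l _.
by rewrite hornerZ horner_exp mulrC.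
Qed.

Lemma expp_coef w j M m : (m <= M)%N -> (expp (clog w j M) M)`_m = cpoly m w j.
Proof.
move=> mM; rewrite /cpoly /expp !coef_sum.
rewrite -!(big_mkord xpredT (fun l => (l`!%:R^-1 *: clog w j _ ^+ l)`_m)).
rewrite (@big_cat_nat _ _ _ m.+1)//= [X in _ + X]big1_seq ?addr0.
  apply: eq_bigr => l _; rewrite !coefZ; congr (_ * _).
  apply: coef_exp_trunc => r rm.
  by rewrite !clog_coef// (leq_trans rm).
move=> l; rewrite mem_index_iota => /andP[_ /andP[ml _]].
by rewrite coefZ coef_exp_lt ?mulr0// clog_coef// expr0 subrr mulr0 mul0r oppr0.
Qed.

Lemma sum_half M : \sum_(r < M.+1) (if r == 0%N :> nat then 0 else 2^-1 ^+ r) <= 1 :> R.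
Proof.
suff -> : \sum_(r < M.+1) (if r == 0%N :> nat then 0 else 2^-1 ^+ r) = 1 - 2^-1 ^+ M :> R.
  by rewrite gerBl exprn_ge0.
elim: M => [|M IH]; first by rewrite big_ord1 expr0 subrr.
by rewrite big_ord_recr IH /= exprS; field; rewrite ?expf_neq0.
Qed.

Lemma poly_coef_horner_le p i x : (forall r, 0 <= p`_r) -> 0 <= x ->
  p`_i * x ^+ i <= p.[x].
Proof.
move=> p0 x0; have term0 r : 0 <= p`_r * x ^+ r by rewrite mulr_ge0 ?exprn_ge0.
have [ip|ip] := ltnP i (size p).
  by rewrite horner_coef (bigD1 (Ordinal ip))//= lerDl sumr_ge0.
by rewrite nth_default// mul0r horner_coef sumr_ge0.
Qed.

Lemma inv_fact_le1 l : l`!%:R^-1 <= 1 :> R.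
Proof. by rewrite invf_le1 ?ler1n ?ltr0n fact_gt0. Qed.

Lemma fact_ge l : (l <= l`!)%N.
Proof. by case: l => // l; rewrite factS leq_pmulr// fact_gt0. Qed.

Lemma normXB_le x y l : `|x| <= 1 -> `|y| <= 1 ->
  `|x ^+ l - y ^+ l| <= l%:R * `|x - y|.
Proof.
move=> x1 y1; elim: l => [|l IH]; first by rewrite !expr0 subrr normr0 mul0r.
have -> : x ^+ l.+1 - y ^+ l.+1 = x * (x ^+ l - y ^+ l) + (x - y) * y ^+ l.
  by rewrite !exprS; ring.
apply: (le_trans (ler_normD _ _)); rewrite !normrM normrX -natr1 mulrDl mul1r.
apply: lerD; last by rewrite ler_piMr// exprn_ile1.
by apply: (le_trans _ IH); rewrite ler_piMl.
Qed.

(* |coefficient of t^r in clog| <= cbound w j ^+ r for r >= 1. *)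
Definition cbound w j : R := (1 + 2 * `|w * j|) * (1 + `|j|).

Lemma cbound_ge1 w j : 1 <= cbound w j.
Proof. by rewrite /cbound -[leLHS]mulr1 ler_pM// ?lerDl// mulr_ge0. Qed.

Lemma clog_bound w j d r :
  `|(clog w j d)`_r| <= if r == 0%N then 0 else cbound w j ^+ r.
Proof.
have [->|r0] := eqVneq r 0%N.
  by rewrite clog_coef// expr0 subrr mulr0 mul0r oppr0 normr0.
have c0 : 0 <= cbound w j by rewrite (le_trans ler01)// cbound_ge1.
rewrite coef_poly; case: ifP => _; last by rewrite normr0 exprn_ge0.
rewrite normrN normrM normrM normrV ?unitfE// normr_nat.
have E1 : `|j ^+ r - 1| <= 2 * (1 + `|j|) ^+ r.
  apply: (le_trans (ler_normB _ _)); rewrite normr1 normrX.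
  have j1 : `|j| ^+ r <= (1 + `|j|) ^+ r by rewrite lerXn2r ?nnegrE ?lerDr ?addr_ge0.
  have j2 : 1 <= (1 + `|j|) ^+ r by rewrite exprn_ege1// lerDl.
  lra.
have E2 : 2 * `|w * j| <= (1 + 2 * `|w * j|) ^+ r.
  have W0 : 0 <= 2 * `|w * j| by rewrite mulr_ge0.
  apply: (@le_trans _ _ (1 + 2 * `|w * j|)); first by rewrite lerDr.
  by rewrite ler_eXnr ?lerDl// lt0n.
apply: (@le_trans _ _ (`|w * j| * `|j ^+ r - 1|)).
  by rewrite ler_piMr ?mulr_ge0// invf_le1 ?ltr0n// ler1n.
apply: (@le_trans _ _ (2 * `|w * j| * (1 + `|j|) ^+ r)).
  by rewrite -mulrA mulrCA ler_wpM2l.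
by rewrite /cbound exprMn ler_wpM2r// exprn_ge0// addr_ge0.
Qed.

Definition clogM w j d : {poly R} :=
  \poly_(r < d.+1) (if r == 0%N then 0 else cbound w j ^+ r).

Lemma clog_boundM w j d r : `|(clog w j d)`_r| <= (clogM w j d)`_r.
Proof.
have := clog_bound w j d r; rewrite [X in _ -> _ <= X]coef_poly.
by case: (ltnP r d.+1) => // rd _; rewrite /clog coef_poly ltnNge rd normr0.
Qed.

Lemma clogM_horner w j d : 0 <= (clogM w j d).[(2 * cbound w j)^-1] <= 1.
Proof.
have c1 := cbound_ge1 w j; have c0 : 0 < cbound w j by exact: lt_le_trans c1.
rewrite horner_poly.
rewrite (eq_bigr (fun r : 'I_d.+1 => if r == 0%N :> nat then 0 else 2^-1 ^+ r)).
  by rewrite sum_half andbT sumr_ge0// => r _; case: ifP.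
move=> r _; case: ifP => _; first by rewrite mul0r.
by rewrite -exprMn; congr (_ ^+ _); field; rewrite gt_eqF.
Qed.

Lemma expp_coef_bound w j M i :
  `|(expp (clog w j M) M)`_i| <= M.+1%:R * (2 * cbound w j) ^+ i.
Proof.
have c1 := cbound_ge1 w j; have c0 : 0 < cbound w j by exact: lt_le_trans c1.
have s0 : 0 < 2 * cbound w j by rewrite mulr_gt0.
have F0 l : 0 <= l`!%:R^-1 :> R by rewrite invr_ge0.
have Q0 l r : 0 <= (clogM w j M ^+ l)`_r.
  exact: le_trans (coef_exp_bound l r (clog_boundM w j M)).
rewrite -ler_pdivrMr ?exprn_gt0// -exprVn.
apply: (@le_trans _ _ ((expp (clogM w j M) M)`_i * (2 * cbound w j)^-1 ^+ i)).
  rewrite ler_wpM2r ?exprn_ge0 ?invr_ge0 ?(ltW s0)// /expp !coef_sum.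
  apply: (le_trans (ler_norm_sum _ _ _)); apply: ler_sum => l _.
  by rewrite !coefZ normrM ger0_norm// ler_wpM2l// (coef_exp_bound _ _ (clog_boundM _ _ _)).
apply: (@le_trans _ _ (expp (clogM w j M) M).[(2 * cbound w j)^-1]).
  apply: poly_coef_horner_le; last by rewrite invr_ge0 ltW.
  by move=> r; rewrite /expp coef_sum sumr_ge0// => l _; rewrite coefZ mulr_ge0.
have /andP[y0 y1] := clogM_horner w j M.
rewrite expp_horner.
have -> : M.+1%:R = \sum_(l < M.+1) 1 :> R by rewrite sumr_const card_ord.
apply: ler_sum => l _; rewrite -[leRHS]mulr1 ler_pM ?exprn_ge0 ?inv_fact_le1//.
by rewrite exprn_ile1.
Qed.

Lemma pseries_horner w j M t : `|t| * (8 * cbound w j) <= 1 ->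
  `|pseries (fun m => cpoly m w j) t M.+1 - (expp (clog w j M) M).[t]|
    <= 2 * 2^-1 ^+ M.
Proof.
have c1 := cbound_ge1 w j; have c0 : 0 < cbound w j by exact: lt_le_trans c1.
move=> tc; set E := expp _ _.
have t4 : `|t| * (2 * cbound w j) <= 4^-1.
  have -> : `|t| * (2 * cbound w j) = 4^-1 * (`|t| * (8 * cbound w j)) by field.
  by rewrite ler_piMr.
rewrite (@horner_coef_wide _ (maxn (size E) M.+1)) ?leq_maxl//.
rewrite /pseries /series /=.
rewrite -(big_mkord xpredT (fun i => E`_i * t ^+ i)).
rewrite (@big_cat_nat _ _ _ M.+1 0 (maxn _ _))//= ?leq_maxr//.
rewrite (eq_big_nat _ _ (F2 := fun i => E`_i * t ^+ i)); last first.
  by move=> i /andP[_ iM]; rewrite expp_coef// -ltnS.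
rewrite opprD addrA subrr add0r normrN.
apply: (le_trans (ler_norm_sum _ _ _)).
have H i : (M.+1 <= i)%N -> `|E`_i * t ^+ i| <= 2^-1 ^+ i.
  move=> Mi; rewrite normrM normrX.
  apply: (@le_trans _ _ (M.+1%:R * (2 * cbound w j) ^+ i * `|t| ^+ i)).
    by rewrite ler_wpM2r ?exprn_ge0// expp_coef_bound.
  rewrite -mulrA -exprMn [_ * `|t|]mulrC.
  apply: (@le_trans _ _ (M.+1%:R * 4^-1 ^+ i)).
    by rewrite ler_wpM2l// lerXn2r ?nnegrE// ?mulr_ge0// ltW.
  have -> : 4^-1 ^+ i = 2^-1 ^+ i * 2^-1 ^+ i :> R.
    by rewrite -exprMn; congr (_ ^+ _); field.
  rewrite mulrA ler_piMl ?exprn_ge0// exprVn ler_pdivrMr ?exprn_gt0// mul1r.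
  rewrite -natrX ler_nat (leq_trans Mi)// ltnW// ltn_expl//.
rewrite big_nat; apply: (@le_trans _ _ (\sum_(M.+1 <= i < maxn (size E) M.+1) 2^-1 ^+ i)).
  by rewrite [leRHS]big_nat; apply: ler_sum => i /andP[iM _]; exact: H.
have G n : (M.+1 <= n)%N -> \sum_(M.+1 <= i < n) 2^-1 ^+ i = 2^-1 ^+ M - 2 * 2^-1 ^+ n :> R.
  elim: n => // n IH; rewrite leq_eqVlt => /predU1P[<-|].
    by rewrite big_geq// exprS; field; rewrite ?expf_neq0.
  by rewrite ltnS => Mn; rewrite big_nat_recr//= IH// exprS; field; rewrite ?expf_neq0.
rewrite G ?leq_maxr//.
have p1 : 0 <= 2^-1 ^+ M :> R by rewrite exprn_ge0.
have p2 : 0 <= 2^-1 ^+ maxn (size E) M.+1 :> R by rewrite exprn_ge0.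
lra.
Qed.

Lemma ln_taylor x N : `|x| <= 2^-1 ->
  `|ln (1 - x) + \sum_(i < N) x ^+ i.+1 / i.+1%:R| <= 2 * `|x| ^+ N.+1.
Proof.
move=> x2.
pose f (y : R) := ln (1 - y) + (\poly_(i < N.+1) (if i == 0%N then 0 else i%:R^-1)).[y] : R.
pose df (y : R) := - (1 - y)^-1 + \sum_(i < N) y ^+ i.
have fE y : f y = ln (1 - y) + \sum_(i < N) y ^+ i.+1 / i.+1%:R.
  rewrite /f horner_poly big_ord_recl /= mul0r add0r; congr (_ + _).
  by apply: eq_bigr => i _; rewrite mulrC.
have dE y : `|y| <= 2^-1 -> is_derive y 1 f (df y).
  move=> y2; have y1 : 0 < 1 - y by have := ler_norm y; lra.
  rewrite /f; apply: is_deriveD.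
    have d1 : is_derive y 1 (fun z : R => 1 - z) (-1).
      have -> : (fun z : R => 1 - z) = cst 1 - id by apply/funext.
      by rewrite -[X in is_derive _ _ _ X]sub0r; apply: is_deriveB.
    have d2 : is_derive (1 - y) 1 (@ln R) (1 - y)^-1 by exact: is_derive1_ln.
    by rewrite -mulrN1; exact: (@is_derive1_comp R (@ln R) (fun z : R => 1 - z) y _ _ d2 d1).
  suff -> : \sum_(i < N) y ^+ i =
    (\poly_(i < N.+1) (if i == 0%N then 0 else i%:R^-1))^`().[y] by exact: is_derive_poly.
  rewrite (@horner_coef_wide _ N); last first.
    by rewrite (leq_trans (size_poly _ _))// -subn1 leq_subLR add1n size_poly.
  apply: eq_bigr => i _; rewrite coef_deriv coef_poly ltnS ltn_ord /=.
  by rewrite -[X in _ = X * _]mulr_natr mulVf ?mul1r // pnatr_eq0.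
have dfE y : `|y| <= `|x| -> `|df y| <= 2 * `|x| ^+ N.
  move=> yx; have y2 : `|y| <= 2^-1 by exact: le_trans x2.
  have y1 : 2^-1 <= 1 - y by have := ler_norm y; lra.
  have y0 : 0 < 1 - y by lra.
  have -> : df y = - (y ^+ N / (1 - y)).
    have -> : y ^+ N = 1 + (y - 1) * \sum_(i < N) y ^+ i by rewrite -subrX1 addrC subrK.
    by rewrite /df; field; rewrite gt_eqF.
  rewrite normrN normrM normrX mulrC ler_pM ?exprn_ge0//; last by rewrite lerXn2r ?nnegrE.
  by rewrite ger0_norm ?invr_ge0 ?(ltW y0)// -[leRHS]invrK lef_pV2 ?posrE ?invr_gt0.
have f0 : f 0 = 0.
  rewrite fE subr0 ln1 add0r big1// => i _.
  by rewrite expr0n mul0r.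
rewrite -fE exprSr mulrA.
have cf a b : -`|x| <= a -> b <= `|x| -> {within `[a, b], continuous f}.
  move=> ax bx; apply: derivable_within_continuous => y.
  rewrite in_itv /= => /andP[ay yb].
  have /dE[] : `|y| <= 2^-1 by rewrite (le_trans _ x2)// ler_norml; lra.
  by [].
have [x0|x0] := leP 0 x.
  have xx : `|x| = x by rewrite ger0_norm.
  have [||c] := @MVT_segment R f df 0 x x0.
  - move=> y; rewrite in_itv /= => /andP[ay yb]; apply: dE.
    by rewrite (le_trans _ x2)// ler_norml; lra.
  - by apply: cf; lra.
  rewrite in_itv /= => /andP[c0 cx]; rewrite f0 !subr0 => ->.
  by rewrite normrM ler_wpM2r// dfE// ler_norml; lra.
have xx : `|x| = - x by rewrite ltr0_norm.
have [||c] := @MVT_segment R f df x 0 (ltW x0).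
- move=> y; rewrite in_itv /= => /andP[ay yb]; apply: dE.
  by rewrite (le_trans _ x2)// ler_norml; lra.
- by apply: cf; lra.
rewrite in_itv /= => /andP[c0 cx]; rewrite f0 !sub0r => fx.
by rewrite -normrN fx normrM normrN ler_wpM2r// dfE// ler_norml; lra.
Qed.

Lemma clog_horner w j M t : t != 0 -> `|t| * (8 * cbound w j) <= 1 ->
  `|(clog w j M).[t] - (w / t * ln (1 - j * t) - j * w / t * ln (1 - t))|
    <= 2 * `|w * j| * (`|j * t| ^+ M.+1 + `|t| ^+ M.+1).
Proof.
move=> t0 tc; have c1 := cbound_ge1 w j.
have cj : `|j| <= cbound w j.
  apply: (@le_trans _ _ (1 + `|j|)); first by rewrite lerDr.
  by rewrite /cbound ler_peMl// ?addr_ge0// lerDl mulr_ge0.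
have tj2 : `|j * t| <= 2^-1.
  have : `|j| * `|t| <= cbound w j * `|t| by rewrite ler_wpM2r.
  by rewrite normrM; lra.
have t2 : `|t| <= 2^-1.
  have : 1 * `|t| <= cbound w j * `|t| by rewrite ler_wpM2r.
  lra.
have L1 := ln_taylor M.+1 tj2; have L2 := ln_taylor M.+1 t2.
set X := (X in `|X| <= _) in L1; set Y := (Y in `|Y| <= _) in L2.
have -> : (clog w j M).[t] - (w / t * ln (1 - j * t) - j * w / t * ln (1 - t))
   = - (w / t * (X - j * Y)).
  have -> : (clog w j M).[t] = - (w / t * (\sum_(i < M.+1) (j * t) ^+ i.+1 / i.+1%:R
       - j * \sum_(i < M.+1) t ^+ i.+1 / i.+1%:R)).
    rewrite horner_poly mulr_sumr -sumrB mulr_sumr -sumrN; apply: eq_bigr => i _.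
    by rewrite exprMn !exprS; field; rewrite t0 andbT nat1r pnatr_eq0.
  by rewrite /X /Y; field.
rewrite normrN normrM.
have XY : `|X - j * Y| <= 2 * `|j| * `|t| * (`|j * t| ^+ M.+1 + `|t| ^+ M.+1).
  apply: (le_trans (ler_normB _ _)).
  have -> : 2 * `|j| * `|t| * (`|j * t| ^+ M.+1 + `|t| ^+ M.+1) =
    2 * `|j * t| ^+ M.+2 + `|j| * (2 * `|t| ^+ M.+2).
    by rewrite ![_ ^+ M.+2]exprS !normrM; ring.
  by rewrite lerD// normrM ler_wpM2l.
apply: (le_trans (ler_wpM2l _ XY)); first by [].
rewrite le_eqVlt; apply/orP; left; apply/eqP.
by rewrite !normrM normfV; field; rewrite normr_eq0.
Qed.

Lemma clog_horner_le1 w j M t : `|t| * (8 * cbound w j) <= 1 ->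
  `|(clog w j M).[t]| <= 1.
Proof.
move=> tc; have c1 := cbound_ge1 w j.
rewrite horner_coef; apply: (le_trans (ler_norm_sum _ _ _)).
rewrite -(big_mkord xpredT (fun i => `|(clog w j M)`_i * t ^+ i|)).
apply: (@le_trans _ _ (\sum_(0 <= i < M.+1) `|(clog w j M)`_i * t ^+ i|)).
  rewrite (@big_cat_nat _ _ _ (size (clog w j M)) 0 M.+1)//= ?size_poly//.
  by rewrite lerDl sumr_ge0.
apply: le_trans (sum_half M); rewrite big_mkord; apply: ler_sum => i _.
have := clog_bound w j M i; rewrite normrM normrX.
case: ifP => _ H.
  by rewrite -[leRHS](mul0r (`|t| ^+ i)) ler_wpM2r// exprn_ge0.
apply: (le_trans (ler_wpM2r _ H)); first by rewrite exprn_ge0.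
have c0 : 0 <= cbound w j by lra.
by rewrite -exprMn lerXn2r ?nnegrE ?mulr_ge0//; lra.
Qed.

(* The defining expansion of the c_m, for all t != 0 close enough to 0. *)
Lemma cpoly_expansion w j : \forall t \near (0 : R)^',
  pseries (fun m => cpoly m w j) t n @[n --> \oo] -->
    (1 - j * t) `^ (w / t) / (1 - t) `^ (j * w / t).
Proof.
have c1 := cbound_ge1 w j; have c0 : 0 < cbound w j by exact: lt_le_trans c1.
have cj : `|j| <= cbound w j.
  apply: (@le_trans _ _ (1 + `|j|)); first by rewrite lerDr.
  by rewrite /cbound ler_peMl// ?addr_ge0// lerDl mulr_ge0.
have e0 : 0 < (8 * cbound w j)^-1 by rewrite invr_gt0 mulr_gt0.
apply/nbhs_ballP; exists (8 * cbound w j)^-1 => //= t.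
rewrite /ball /= sub0r normrN => te t0.
have {te}tc : `|t| * (8 * cbound w j) <= 1 by rewrite -ler_pdivlMr ?mulr_gt0// mul1r ltW.
have tj : `|j * t| <= 8^-1.
  have : `|j| * `|t| <= cbound w j * `|t| by rewrite ler_wpM2r.
  by rewrite normrM; lra.
have t8 : `|t| <= 8^-1.
  have : 1 * `|t| <= cbound w j * `|t| by rewrite ler_wpM2r.
  lra.
have tj0 : 0 < 1 - j * t by have := ler_norm (j * t); lra.
have t10 : 0 < 1 - t by have := ler_norm t; lra.
rewrite /powR !gt_eqF// -expRB.
set A := (X in expR X).
have A1 : `|A| <= 1.
  have := clog_horner 0 t0 tc.
  rewrite horner_poly big_ord1 expr0 subrr !(mulr0, mul0r, oppr0) sub0r normrN !expr1.
  move/le_trans; apply; rewrite [`|j * t|]normrM mulrC.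
  have -> : (`|j| * `|t| + `|t|) * (2 * `|w * j|) = `|t| * (2 * `|w * j| * (1 + `|j|)).
    by ring.
  have : `|t| * (2 * `|w * j| * (1 + `|j|)) <= `|t| * cbound w j.
    by rewrite ler_wpM2l// /cbound ler_wpM2r ?addr_ge0// lerDr.
  have : 0 <= `|t| * cbound w j by rewrite mulr_ge0 ?(ltW c0)//.
  lra.
have H M : `|pseries (fun m => cpoly m w j) t M.+1 - series (exp_coeff A) M.+1|
    <= (2 + 4 * `|w * j|) * 2^-1 ^+ M.
  have P1 := clog_horner_le1 M tc; have D := clog_horner M t0 tc.
  rewrite -/A in D; set P := (clog w j M).[t] in P1 D.
  rewrite (le_trans (ler_distD (expp (clog w j M) M).[t] _ _))// mulrDl lerD//.
    exact: pseries_horner.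
  rewrite expp_horner -/P /series /exp_coeff /= big_mkord -sumrB.
  apply: (le_trans (ler_norm_sum _ _ _)).
  apply: (@le_trans _ _ (\sum_(l < M.+1) `|P - A|)).
    apply: ler_sum => l _; rewrite -mulrBl normrM normfV normr_nat.
    rewrite ler_pdivrMr ?ltr0n ?fact_gt0// mulrC (le_trans (normXB_le l P1 A1))//.
    by rewrite ler_wpM2r// ler_nat fact_ge.
  rewrite sumr_const card_ord -[leLHS]mulr_natl.
  have D4 : `|P - A| <= 4 * `|w * j| * (2^-1 ^+ M * 2^-1 ^+ M).
    apply: (le_trans D).
    have q x : 0 <= x -> x <= 8^-1 -> x ^+ M.+1 <= 2^-1 ^+ M * 2^-1 ^+ M.
      move=> x0 x8; rewrite -exprMn exprSr -[leRHS]mulr1 ler_pM ?exprn_ge0//; last by lra.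
      by rewrite lerXn2r ?nnegrE ?mulr_ge0//; lra.
    have := q _ (normr_ge0 _) tj; have := q _ (normr_ge0 _) t8 => q1 q2.
    have -> : 4 * `|w * j| * (2^-1 ^+ M * 2^-1 ^+ M) =
      2 * `|w * j| * (2^-1 ^+ M * 2^-1 ^+ M + 2^-1 ^+ M * 2^-1 ^+ M) by ring.
    by rewrite ler_wpM2l ?mulr_ge0// lerD.
  apply: (@le_trans _ _ (M.+1%:R * (4 * `|w * j| * (2^-1 ^+ M * 2^-1 ^+ M)))).
    by rewrite ler_wpM2l.
  rewrite mulrCA ler_wpM2l ?mulr_ge0// mulrA ler_piMl ?exprn_ge0//.
  by rewrite exprVn ler_pdivrMr ?exprn_gt0// mul1r -natrX ler_nat ltn_expl.
rewrite -(cvg_shiftS (pseries _ t)) /=.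
have E : series (exp_coeff A) n.+1 @[n --> \oo] --> expR A.
  by rewrite (cvg_shiftS (series (exp_coeff A))); exact: is_cvg_series_exp_coeff.
have Z : (pseries (fun m => cpoly m w j) t n.+1 - series (exp_coeff A) n.+1)
    @[n --> \oo] --> (0 : R).
  apply/norm_cvg0P.
  apply: (@squeeze_cvgr _ _ _ _ (fun=> 0) (fun n => (2 + 4 * `|w * j|) * 2^-1 ^+ n)).
  - by apply: nearW => n; rewrite normr_ge0 H.
  - exact: cvg_cst.
  - by apply: cvg_geometric; rewrite ger0_norm; lra.
have := cvgD Z E; rewrite add0r; move/(_ _).
apply: cvg_trans; apply: near_eq_cvg; apply: nearW => n /=.
by rewrite fctE subrK.
Qed.

End Expansion.

(* Main.v *)
(* Put t = 1/k, w = n/k and q = (1 - t)^n, so that (1 - j/k)^n = q^j F(j) with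
   F(j) = sum_m c_m(w, j) t^m. For any G, expanded in falling factorials,
     sum_j (-q)^j C(k, j) G(j)
       = sum_r C(k, r) (-q)^r (1 - q)^(k - r) (Delta^r G)(0),
   which captures the cancellation between the alternating terms: the factor
   (1 - q)^k comes out, and C(k, r) (q / (1 - q))^r <= mu^r / r! with mu of the
   order of lambda. It remains to bound the differences at 0 of
   G = F - sum_(m <= N) c_m t^m.
   The functions j (j^s - 1) have nonnegative differences at 0, and by the
   Leibniz rule domination of differences is stable under products. Hence those
   of c_m are dominated by those of the coefficient of t^m in
   H(t) = exp (w j sum_s (j^s - 1) / (s + 1) t^s), and for A >= 1 and R >= r
     C(R, r) |Delta^r G (0)| <= A^-(N+1) H(A t) at j = R.
   With R = 2L, L of the order of lambda + log n and A = 1 + k / (w L^2), the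
   exponential stays bounded and the sum over r <= L is geometric. For r > L,
   0 <= F <= 1 gives |Delta^r G (0)| <= 2^r and the tail is negligible. *)
Require Import Defs.
From mathcomp Require Import all_boot all_order all_algebra.
From mathcomp Require Import all_classical all_reals all_analysis.
From mathcomp Require Import ring lra zify.

Set Implicit Arguments.
Unset Strict Implicit.
Unset Printing Implicit Defensive.

Import Order.TTheory GRing.Theory Num.Theory.
Import numFieldNormedType.Exports.
Local Open Scope ring_scope.

(** * Newton series *)

Section NewtonSeries.
Variable R : realType.
Implicit Types (f g : nat -> R) (r j k : nat).

(* [ncoef f r] is the r-th forward difference of [f] at 0, that is [r!] times
   the coefficient of the falling factorial of degree r in the Newton series
   of [f]. *)
Definition fdiff f j := f j.+1 - f j.

Definition ncoef f r := iter r fdiff f 0%N.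

Lemma ncoef0 f : ncoef f 0 = f 0%N. Proof. by []. Qed.

Lemma ncoefS f r : ncoef f r.+1 = ncoef (fdiff f) r.
Proof. by rewrite /ncoef iterSr. Qed.

Lemma eq_ncoef f g r : f =1 g -> ncoef f r = ncoef g r.
Proof. by move=> /funext ->. Qed.

Lemma ncoefD f g r : ncoef (fun j => f j + g j) r = ncoef f r + ncoef g r.
Proof.
elim: r f g => // r IH f g; rewrite !ncoefS -IH; apply: eq_ncoef => j.
by rewrite /fdiff opprD addrACA.
Qed.

Lemma ncoefZ a f r : ncoef (fun j => a * f j) r = a * ncoef f r.
Proof.
elim: r f => // r IH f; rewrite !ncoefS -IH; apply: eq_ncoef => j.
by rewrite /fdiff mulrBr.
Qed.

Lemma ncoefN f r : ncoef (fun j => - f j) r = - ncoef f r.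
Proof. by rewrite -mulN1r -ncoefZ; apply: eq_ncoef => j; rewrite mulN1r. Qed.

Lemma ncoef_cst0 r : ncoef (fun=> 0) r = 0.
Proof. by rewrite -[RHS](mul0r (ncoef (fun=> 0) r)) -ncoefZ; apply: eq_ncoef => j; rewrite mul0r. Qed.

Lemma ncoef_sum (I : Type) (s : seq I) (P : pred I) (F : I -> nat -> R) r :
  ncoef (fun j => \sum_(i <- s | P i) F i j) r = \sum_(i <- s | P i) ncoef (F i) r.
Proof.
elim: s => [|i s IH].
  by rewrite big_nil -[RHS](ncoef_cst0 r); apply: eq_ncoef => j; rewrite big_nil.
rewrite big_cons -IH; case: (boolP (P i)) => Pi.
  by rewrite -ncoefD; apply: eq_ncoef => j; rewrite big_cons Pi.
by apply: eq_ncoef => j; rewrite big_cons (negbTE Pi).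
Qed.

Lemma ncoef_bound f r b : (forall j, (j <= r)%N -> `|f j| <= b) ->
  `|ncoef f r| <= 2 ^+ r * b.
Proof.
elim: r f b => [|r IH] f b fb; first by rewrite mul1r fb.
rewrite ncoefS exprSr -mulrA; apply: IH => j jr.
by rewrite mulr_natl mulr2n (le_trans (ler_normB _ _))// lerD// fb// ltnW.
Qed.

Lemma cvg_ncoef (F : nat -> nat -> R) f r :
  (forall j, (j <= r)%N -> F M j @[M --> \oo]%classic --> f j)%classic ->
  (ncoef (F M) r @[M --> \oo] --> ncoef f r)%classic.
Proof.
elim: r F f => [|r IH] F f Ff; first exact: Ff.
rewrite ncoefS; under eq_fun do rewrite ncoefS.
apply: (IH (fun M => fdiff (F M))) => j jr; rewrite /fdiff.
by apply: cvgB; apply: Ff => //; rewrite ltnW.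
Qed.

(* The Newton formula and the two binomial transforms below all satisfy this
   recursion. *)
Lemma binomial_recE (T : nat -> (nat -> R) -> R) a b :
  (forall f, T 0%N f = f 0%N) ->
  (forall k f, T k.+1 f = a * T k f + b * T k (fdiff f)) ->
  forall k f, T k f = \sum_(r < k.+1) 'C(k, r)%:R * b ^+ r * a ^+ (k - r) * ncoef f r.
Proof.
move=> T0 TS; elim=> [|k IH] f.
  by rewrite T0 big_ord1 bin0 !mul1r.
rewrite TS !IH big_ord_recl [RHS]big_ord_recl !bin0 !subn0 /= mulrDr.
(* The added term [i = k] vanishes since 'C(k, k.+1) = 0; the two sums joined by Pascal's rule then
   have the same range. *)
rewrite [\sum_(i < k) _](_ : _ = \sum_(i < k.+1)
    'C(k, i.+1)%:R * b ^+ i.+1 * a ^+ (k - i.+1) * ncoef f i.+1); last first.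
  by rewrite [RHS]big_ord_recr/= bin_small// !mul0r addr0.
rewrite -addrA exprS !mulrA; congr (_ + _); first by ring.
rewrite !mulr_sumr -big_split; apply: eq_bigr => i _ /=.
rewrite /bump /= add1n subSS binS natrD -ncoefS.
have [ik|ik] := ltnP i k.
  have -> : (k - i = (k - i.+1).+1)%N by rewrite subnSK.
  rewrite !exprS; ring.
have -> : (i = k :> nat)%N by apply/eqP; rewrite eqn_leq ik -ltnS ltn_ord.
by rewrite bin_small// subnn !exprS; ring.
Qed.

Lemma newton_formula f k : f k = \sum_(r < k.+1) 'C(k, r)%:R * ncoef f r.
Proof.
rewrite (@binomial_recE (fun k f => f k) 1 1)//.
  by apply: eq_bigr => r _; rewrite !expr1n !mulr1.
by move=> m g; rewrite !mul1r /fdiff addrC subrK.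
Qed.

(** By Pascal's rule the left side satisfies the recursion with [a = 1 + x] and [b = x]. At
    [x = - q] the powers of [1 + x] yield the factor [1 - q]. *)
Lemma binomial_transform f k x :
  \sum_(j < k.+1) 'C(k, j)%:R * x ^+ j * f j =
  \sum_(r < k.+1) 'C(k, r)%:R * x ^+ r * (1 + x) ^+ (k - r) * ncoef f r.
Proof.
apply: (@binomial_recE (fun k f => \sum_(j < k.+1) 'C(k, j)%:R * x ^+ j * f j)).
  by move=> g; rewrite big_ord1 bin0 !mul1r.
move=> m g; rewrite big_ord_recl !bin0 /=.
rewrite (eq_bigr (fun i : 'I_m.+1 => 'C(m, i.+1)%:R * x ^+ i.+1 * g i.+1
   + x * ('C(m, i)%:R * x ^+ i * g i.+1))); last first.
  by move=> i _; rewrite /bump /= add1n binS natrD exprS; ring.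
rewrite big_split /= addrA.
rewrite [X in X + _](_ : _ = \sum_(j < m.+1) 'C(m, j)%:R * x ^+ j * g j); last first.
  rewrite [in LHS]big_ord_recr/= bin_small// !mul0r addr0.
  by rewrite [RHS]big_ord_recl bin0.
rewrite mulrDl mul1r -addrA; congr (_ + _).
rewrite !mulr_sumr -big_split; apply: eq_bigr => i _ /=.
by rewrite /fdiff; ring.
Qed.

(** Here [a = 0] and [b = 1] in [binomial_recE], so [0 ^+ (k - r)] leaves only the term [r = k]. *)
Lemma ncoef_alt f k :
  ncoef f k = \sum_(j < k.+1) (-1) ^+ (k - j) * 'C(k, j)%:R * f j.
Proof.
rewrite (@binomial_recE (fun k f => \sum_(j < k.+1) (-1) ^+ (k - j) * 'C(k, j)%:R * f j) 0 1).
- rewrite big_ord_recr /= binn subnn !mul1r expr1n !mul1r big1 ?add0r// => i _.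
  by rewrite expr0n subn_eq0 leqNgt ltn_ord /= mulr0 mul0r.
- by move=> g; rewrite big_ord1 bin0 !mul1r.
move=> m g; rewrite mul0r add0r mul1r big_ord_recl !bin0 /= subn0.
rewrite (eq_bigr (fun i : 'I_m.+1 => (-1) ^+ (m - i) * 'C(m, i.+1)%:R * g i.+1
   + (-1) ^+ (m - i) * 'C(m, i)%:R * g i.+1)); last first.
  by move=> i _; rewrite /bump /= add1n subSS binS natrD; ring.
rewrite big_split /= addrA.
rewrite [X in X + _](_ : _ = - \sum_(j < m.+1) (-1) ^+ (m - j) * 'C(m, j)%:R * g j); last first.
  rewrite [in LHS]big_ord_recr/= bin_small// !(mul0r, mulr0) addr0.
  rewrite [in RHS]big_ord_recl bin0 subn0 exprS opprD; congr (_ + _); first by ring.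
  rewrite -sumrN; apply: eq_bigr => i _; rewrite /bump /= ?add1n.
  have -> : (m - i = (m - i.+1).+1)%N by rewrite subnSK.
  by rewrite exprS; ring.
rewrite -sumrN -big_split; apply: eq_bigr => i _ /=.
by rewrite /fdiff; ring.
Qed.

(** Needed because the logarithmic form of (1 - j/k)^n is available only for [j < k]. *)
Lemma ncoef_local f g r :
  (forall j, (j <= r)%N -> f j = g j) -> ncoef f r = ncoef g r.
Proof.
move=> fg; rewrite !ncoef_alt; apply: eq_bigr => j _.
by rewrite fg// -ltnS.
Qed.

(** The binomials form the basis dual to the differences at 0. *)
Lemma ncoef_bin i r : ncoef (fun j => 'C(j, i)%:R) r = (i == r)%:R.
Proof.
elim: r i => [|r IH] [|i]; rewrite ?ncoef0 ?ncoefS ?bin0 ?bin0n//.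
  rewrite -[RHS](ncoef_cst0 r); apply: eq_ncoef => j; by rewrite /fdiff !bin0 subrr.
rewrite -[RHS]/((i == r)%:R) -IH; apply: eq_ncoef => j.
by rewrite /fdiff binS natrD addrAC subrr add0r.
Qed.

(** * Domination of forward differences *)

(** The right side bounds an absolute value, so all differences of [g] at 0 are nonnegative;
    [maj f f] expresses exactly this for [f]. *)
Definition maj f g := forall r, `|ncoef f r| <= ncoef g r.

Lemma maj_fdiff f g : maj f g -> maj (fdiff f) (fdiff g).
Proof. by move=> fg r; have := fg r.+1; rewrite !ncoefS. Qed.

Lemma majD f1 f2 g1 g2 : maj f1 g1 -> maj f2 g2 ->
  maj (fun j => f1 j + f2 j) (fun j => g1 j + g2 j).
Proof. by move=> m1 m2 r; rewrite !ncoefD (le_trans (ler_normD _ _))// lerD. Qed.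

Lemma majZ a f g : 0 <= a -> maj f g -> maj (fun j => a * f j) (fun j => a * g j).
Proof. by move=> a0 m r; rewrite !ncoefZ normrM ger0_norm// ler_wpM2l. Qed.

Lemma majN f : maj f f -> maj (fun j => - f j) f.
Proof. by move=> m r; rewrite ncoefN normrN. Qed.

Lemma maj_sum (I : Type) (s : seq I) (F G : I -> nat -> R) :
  (forall i, maj (F i) (G i)) ->
  maj (fun j => \sum_(i <- s) F i j) (fun j => \sum_(i <- s) G i j).
Proof.
by move=> m r; rewrite !ncoef_sum (le_trans (ler_norm_sum _ _ _))// ler_sum => // i _; apply: m.
Qed.

(** The discrete Leibniz rule with all factors taken at the same point [j]: only plus signs occur,
    so domination and degree bounds pass to products by induction. *)
Lemma fdiffM f g : fdiff (fun j => f j * g j) =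
  (fun j => fdiff f j * g j + (f j * fdiff g j + fdiff f j * fdiff g j)).
Proof. by apply/funext => j; rewrite /fdiff; ring. Qed.

Lemma majM f1 f2 g1 g2 : maj f1 g1 -> maj f2 g2 ->
  maj (fun j => f1 j * f2 j) (fun j => g1 j * g2 j).
Proof.
move=> + + r; elim: r f1 f2 g1 g2 => [|r IH] f1 f2 g1 g2 m1 m2.
  by have := m1 0%N; have := m2 0%N; rewrite !ncoef0 normrM => ? ?; rewrite ler_pM.
rewrite !ncoefS !fdiffM !ncoefD.
apply: (le_trans (ler_normD _ _)); apply: lerD.
  by apply: IH => //; apply: maj_fdiff.
apply: (le_trans (ler_normD _ _)); apply: lerD; apply: IH => //; exact: maj_fdiff.
Qed.

Lemma eq_maj f1 f2 g1 g2 : f1 =1 f2 -> g1 =1 g2 -> maj f1 g1 -> maj f2 g2.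
Proof. by move=> /funext -> /funext ->. Qed.

Lemma maj_cst a : 0 <= a -> maj (fun=> a) (fun=> a).
Proof.
move=> a0 [|r]; first by rewrite ncoef0 ger0_norm.
rewrite ncoefS (_ : fdiff _ = fun=> 0) ?ncoef_cst0 ?normr0//.
by apply/funext => j; rewrite /fdiff subrr.
Qed.

Lemma maj_nat : maj (fun j => j%:R) (fun j => j%:R).
Proof.
case=> [|r]; first by rewrite ncoef0 normr0.
rewrite ncoefS (_ : fdiff _ = fun=> 1); first exact: maj_cst.
by apply/funext => j; rewrite /fdiff -natr1 addrAC subrr add0r.
Qed.

(** Induction through j^(s+2) - j = j (j^(s+1) - j) + (j^2 - j). These functions are the j (j^s - 1)
    in the coefficients of [clog]. *)
Lemma maj_natX s : maj (fun j => j%:R ^+ s.+1 - j%:R) (fun j => j%:R ^+ s.+1 - j%:R).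
Proof.
elim: s => [|s IH].
  apply: (eq_maj (f1 := fun=> 0) (g1 := fun=> 0)); last exact: maj_cst.
    by move=> j; rewrite subrr.
  by move=> j; rewrite subrr.
have bas : maj (fun j => j%:R * j%:R - j%:R) (fun j => j%:R * j%:R - j%:R).
  case=> [|r]; first by rewrite ncoef0 mul0r subrr normr0.
  rewrite ncoefS (_ : fdiff _ = fun j => 2 * j%:R); first exact: (majZ _ maj_nat).
  by apply/funext => j; rewrite /fdiff -natr1; ring.
pose h j : R := j%:R * (j%:R ^+ s.+1 - j%:R) + (j%:R * j%:R - j%:R).
have hE : h =1 (fun j => j%:R ^+ s.+2 - j%:R) by move=> j; rewrite /h [in RHS]exprS; ring.
by apply: (eq_maj hE hE); apply: majD => //; apply: majM => //; apply: maj_nat.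
Qed.

(* Newton's formula at [j] has only nonnegative terms. *)
Lemma ncoef_le f r j : maj f f -> (r <= j)%N -> 'C(j, r)%:R * ncoef f r <= f j.
Proof.
move=> m rj; rewrite [leRHS](newton_formula f j) (bigD1 (Ordinal (rj : r < j.+1)%N))//=.
rewrite lerDl sumr_ge0// => i _; rewrite mulr_ge0//.
exact: le_trans (m i).
Qed.

(* Polynomial degree less than [d], with [nsize f 0] meaning [f = 0]. *)
Definition nsize f d := forall r, (d <= r)%N -> ncoef f r = 0.

Lemma nsize0 f j : nsize f 0 -> f j = 0.
Proof. by move=> f0; rewrite (newton_formula f) big1// => i _; rewrite f0 ?mulr0. Qed.

Lemma nsizeW f a b : (a <= b)%N -> nsize f a -> nsize f b.
Proof. by move=> ab fa r br; apply: fa; exact: leq_trans br. Qed.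

(** Induction on the order of the difference: each summand of [fdiffM] lowers at least one of the
    sizes. For nonzero sizes the bound exceeds the exact degree count by one. *)
Lemma nsizeM f g a b : nsize f a -> nsize g b -> nsize (fun j => f j * g j) (a + b).
Proof.
have z (h1 h2 : nat -> R) r : nsize h1 0 -> ncoef (fun j => h1 j * h2 j) r = 0.
  move=> h0; rewrite -[RHS](ncoef_cst0 r); apply: eq_ncoef => j.
  by rewrite nsize0// mul0r.
move=> + + r; elim: r f g a b => [|r IH] f g [|a] b fa gb //= rab.
- exact: z.
- exact: z.
case: b gb rab => [|b] gb rab.
  by rewrite (eq_ncoef (g := fun j => g j * f j)) ?z// => j; rewrite mulrC.
have fa' : nsize (fdiff f) a by move=> i ai; rewrite -ncoefS fa.
have gb' : nsize (fdiff g) b by move=> i bi; rewrite -ncoefS gb.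
move: rab; rewrite addSn ltnS => rab.
rewrite ncoefS fdiffM !ncoefD (IH _ _ a b.+1)// (IH _ _ a.+1 b) ?addSnnS//.
by rewrite (IH _ _ a b) ?addr0// (leq_trans _ rab)// leq_add2l.
Qed.

Lemma nsizeD f g d : nsize f d -> nsize g d -> nsize (fun j => f j + g j) d.
Proof. by move=> fd gd r dr; rewrite ncoefD fd// gd// addr0. Qed.

Lemma nsizeZ a f d : nsize f d -> nsize (fun j => a * f j) d.
Proof. by move=> fd r dr; rewrite ncoefZ fd// mulr0. Qed.

Lemma nsize_sum (I : Type) (s : seq I) (F : I -> nat -> R) d :
  (forall i, nsize (F i) d) -> nsize (fun j => \sum_(i <- s) F i j) d.
Proof. by move=> H r dr; rewrite ncoef_sum big1// => i _; apply: H. Qed.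

Lemma nsize_cst a : nsize (fun=> a) 1.
Proof.
case=> // r _; rewrite ncoefS -[RHS](ncoef_cst0 r); apply: eq_ncoef => j.
by rewrite /fdiff subrr.
Qed.

Lemma nsize_nat : nsize (fun j => j%:R) 2.
Proof.
case=> [|[|r]]// _; rewrite ncoefS.
rewrite (_ : fdiff _ = fun=> 1); first exact: nsize_cst.
by apply/funext => j; rewrite /fdiff -natr1 addrAC subrr add0r.
Qed.

Lemma nsize_natX s : nsize (fun j => j%:R ^+ s) s.+1.
Proof.
elim: s => [|s IH]; first exact: nsize_cst.
(* Multiplication by [j] raises the size by one only, whereas [nsizeM] with [nsize_nat] would give
   two. *)
suff H f d : nsize f d.+1 -> nsize (fun j => j%:R * f j) d.+2.
  by move=> r rs; rewrite -(H _ _ IH r rs); apply: eq_ncoef => j; rewrite exprS.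
elim: d f => [|d IHd] f fd [|r]// dr.
  have -> : f = fun=> f 0%N.
    apply/funext => j; rewrite (newton_formula f) big_ord_recl bin0 mul1r big1 ?addr0//.
    by move=> i _; rewrite fd ?mulr0.
  rewrite (eq_ncoef (g := fun j => f 0%N * j%:R)); first by rewrite ncoefZ nsize_nat ?mulr0.
  by move=> j; rewrite mulrC.
rewrite ncoefS (_ : fdiff _ = fun j => j%:R * fdiff f j + (fdiff f j + f j)); last first.
  by apply/funext => j; rewrite /fdiff -natr1; ring.
have fd' : nsize (fdiff f) d.+1 by move=> i di; rewrite -ncoefS fd.
by rewrite ncoefD (IHd _ fd')// add0r ncoefD fd' ?fd ?addr0// ltnW.
Qed.

End NewtonSeries.

(** * Stirling numbers *)

Section Stirling.
Variables n k : nat.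
Implicit Types (P : {set {set 'I_n}}) (f : {ffun 'I_n -> 'I_k}).

Lemma pblock_preim_partition f x y :
  (y \in finset.pblock (finset.preim_partition f [set: 'I_n]%SET) x) = (f x == f y).
Proof.
rewrite (@finset.pblock_equivalence_partition _ (fun x y => f x == f y) [set: 'I_n]%SET) ?inE//.
by split=> // /eqP ->.
Qed.

(** [h] composes a function on the blocks with the block map [blk]. It sends the injections
    bijectively onto the functions with kernel [P]; the inverse evaluates at the representatives
    [rep]. *)
Lemma card_preim_partition P : finset.partition P [set: 'I_n]%SET ->
  #|[set f : {ffun 'I_n -> 'I_k} | finset.preim_partition f [set: 'I_n]%SET == P]%SET| = (k ^_ #|P|)%N.
Proof.
move=> PP; have [/eqP cP tP P0] := and3P PP.
pose T : finType := {B : {set 'I_n} | B \in P}.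
have bP x : finset.pblock P x \in P by rewrite finset.pblock_mem ?cP ?inE.
pose blk x : T := exist _ (finset.pblock P x) (bP x).
have blkE x y : (blk x == blk y) = (y \in finset.pblock P x).
  by rewrite -val_eqE /= finset.eq_pblock ?cP ?inE.
have blks (B : T) : exists x, blk x == B.
  have /set0Pn[x xB] : sval B != finset.set0 by apply: contraNneq P0 => <-; apply: (svalP B).
  by exists x; rewrite -val_eqE /=; apply/eqP; rewrite (finset.def_pblock tP (svalP B) xB).
pose h (g : {ffun T -> 'I_k}) := [ffun x => g (blk x)].
have hinj : injective h.
  move=> g1 g2 /ffunP h12; apply/ffunP => B.
  have [x /eqP <-] := blks B; have := h12 x; by rewrite !ffunE.
pose rep B := xchoose (blks B).
have repK B : blk (rep B) = B by apply/eqP; apply: (xchooseP (blks B)).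
clearbody rep; have cT : #|T| = #|P| by rewrite card_sig.
rewrite -cT -[X in (X ^_ _)%N]card_ord -card_inj_ffuns.
rewrite -(card_imset _ hinj); apply/eq_card => f; rewrite inE.
apply/eqP/imsetP => [fP|[g]].
  exists [ffun B => f (rep B)].
    rewrite inE; apply/injectiveP => B1 B2; rewrite !ffunE => /eqP.
    by rewrite -pblock_preim_partition fP -blkE !repK => /eqP.
  apply/ffunP => x; rewrite !ffunE; apply/eqP.
  by rewrite -pblock_preim_partition fP -blkE repK.
rewrite inE => /injectiveP ginj ->.
rewrite -[RHS](finset.equivalence_partition_pblock PP).
rewrite /finset.preim_partition /finset.equivalence_partition.
apply: eq_in_imset => x _; apply/setP => y; rewrite !inE !ffunE.
by rewrite (inj_eq ginj) blkE.
Qed.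

(* A function is an injection defined on the blocks of its kernel. *)
Lemma expn_sum_ffact :
  (k ^ n)%N = (\sum_(P : {set {set 'I_n}} | finset.partition P [set: 'I_n]%SET) k ^_ #|P|)%N.
Proof.
rewrite -{1}(card_ord k) -{1}(card_ord n) -card_ffun -sum1_card.
rewrite (partition_big (fun f : {ffun 'I_n -> 'I_k} => finset.preim_partition f [set: 'I_n]%SET)
  (fun P => finset.partition P [set: 'I_n]%SET)) /=; last first.
  by move=> f _; exact: finset.preim_partitionP.
by apply: eq_bigr => P PP; rewrite -card_preim_partition// -sum1_card; apply: eq_bigl => f; rewrite !inE.
Qed.

End Stirling.

(** By [expn_sum_ffact], j^n is a sum over partitions [P] of multiples of 'C(j, #|P|), and the k-th
    difference at 0 keeps those with [k] blocks. *)
Lemma stirling2_ncoef (R : realType) n k :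
  (stirling2 n k)%:R * k`!%:R = ncoef (fun j => j%:R ^+ n) k :> R.
Proof.
rewrite (eq_ncoef (g := fun j => \sum_(P : {set {set 'I_n}} |
   finset.partition P [set: 'I_n]%SET) (#|P|)`!%:R * 'C(j, #|P|)%:R)); last first.
  move=> j; rewrite -natrX expn_sum_ffact natr_sum; apply: eq_bigr => P _.
  by rewrite -natrM mulnC bin_ffact.
rewrite ncoef_sum /stirling2 -sum1_card natr_sum mulr_suml.
under [RHS]eq_bigr do rewrite ncoefZ ncoef_bin.
rewrite [RHS](bigID (fun P : {set {set 'I_n}} => #|P| == k)) /= [X in _ + X]big1 ?addr0.
  apply: eq_big => [P|P]; first by rewrite inE.
  by rewrite inE => /andP[_ /eqP ->]; rewrite eqxx mulr1 mul1r.
by move=> P /andP[_ /negbTE ->]; rewrite mulr0.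
Qed.

(** The alternating sum for the k-th difference of j^n, with [j] replaced by [k - j]. *)
Lemma SnkE (R : realType) n k : (0 < k)%N -> Snk R n k =
  \sum_(j < k.+1) (-1) ^+ j * 'C(k, j)%:R * (1 - j%:R / k%:R) ^+ n.
Proof.
move=> k0; rewrite /Snk stirling2_ncoef ncoef_alt mulr_suml (reindex_inj rev_ord_inj) /=.
apply: eq_bigr => j _; have jk : (j <= k)%N by rewrite -ltnS.
rewrite subSS subKn// bin_sub// natrB// -[LHS]mulrA -expr_div_n.
by congr (_ * _ ^+ _); field; rewrite pnatr_eq0 -lt0n.
Qed.

(** * The polynomials c_m *)

Section ExponentialCoefficients.
Variable R : realType.
Implicit Types (w t x A : R) (j q r s l m N M D : nat) (P Q : nat -> {poly R}).

Lemma sum_exp_coeff_le x M : 0 <= x -> \sum_(l < M) x ^+ l / l`!%:R <= expR x.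
Proof.
move=> x0; rewrite -(big_mkord xpredT (fun l => x ^+ l / l`!%:R)).
rewrite -[leLHS]/(series (exp_coeff x) M) /expR.
apply: nondecreasing_cvgn_le; last exact: is_cvg_series_exp_coeff.
by apply: nondecreasing_series => i _ _; exact: exp_coeff_ge0.
Qed.

(** Up to degree [D] the coefficients of [- clog] are nonnegative multiples of j^(s+1) - j; beyond
    it both sides vanish. *)
Lemma maj_clog w D s : 0 <= w ->
  maj (fun j => (clog w j%:R D)`_s) (fun j => (- clog w j%:R D)`_s).
Proof.
move=> w0; pose h j : R := w / s.+1%:R * (j%:R ^+ s.+1 - j%:R).
have mh : maj h h by apply: majZ; [rewrite divr_ge0|exact: maj_natX].
have [sD|sD] := ltnP s D.+1.
  have hE j : (- clog w j%:R D)`_s = h j.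
    rewrite coefN coef_poly sD opprK /h exprS; field.
    by rewrite nat1r pnatr_eq0.
  apply: (eq_maj _ _ (majN mh)) => j; last by rewrite hE.
  by rewrite -hE coefN opprK.
apply: (eq_maj (f1 := fun=> 0) (g1 := fun=> 0)); last exact: maj_cst.
  by move=> j; rewrite coef_poly ltnNge sD.
by move=> j; rewrite coefN coef_poly ltnNge sD oppr0.
Qed.

Lemma maj_coefX P Q l s :
  (forall s, maj (fun j => (P j)`_s) (fun j => (Q j)`_s)) ->
  maj (fun j => (P j ^+ l)`_s) (fun j => (Q j ^+ l)`_s).
Proof.
move=> PQ; elim: l s => [|l IH] s.
  apply: (eq_maj (f1 := fun=> (s == 0%N)%:R) (g1 := fun=> (s == 0%N)%:R)).
  - by move=> j; rewrite expr0 coef1.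
  - by move=> j; rewrite expr0 coef1.
  exact: maj_cst.
apply: (eq_maj (f1 := fun j => \sum_(i < s.+1) (P j)`_i * (P j ^+ l)`_(s - i))
   (g1 := fun j => \sum_(i < s.+1) (Q j)`_i * (Q j ^+ l)`_(s - i))).
- by move=> j; rewrite exprS coefM.
- by move=> j; rewrite exprS coefM.
by apply: maj_sum => i; apply: majM.
Qed.

Lemma maj_expp P Q M s :
  (forall s, maj (fun j => (P j)`_s) (fun j => (Q j)`_s)) ->
  maj (fun j => (expp (P j) M)`_s) (fun j => (expp (Q j) M)`_s).
Proof.
move=> PQ.
apply: (eq_maj (f1 := fun j => \sum_(l < M.+1) l`!%:R^-1 * (P j ^+ l)`_s)
   (g1 := fun j => \sum_(l < M.+1) l`!%:R^-1 * (Q j ^+ l)`_s)).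
- by move=> j; rewrite coef_sum; apply: eq_bigr => l _; rewrite coefZ.
- by move=> j; rewrite coef_sum; apply: eq_bigr => l _; rewrite coefZ.
by apply: maj_sum => l; apply: majZ; [rewrite invr_ge0|exact: maj_coefX].
Qed.

Lemma size_expp (p : {poly R}) M : (size (expp p M) <= ((size p).-1 * M).+1)%N.
Proof.
apply: (leq_trans (size_sum _ _ _)); apply/bigmax_leqP => l _.
apply: (leq_trans (size_scale_leq _ _)); apply: (leq_trans (size_poly_exp_leq _ _)).
by rewrite ltnS leq_mul2l -ltnS ltn_ord orbT.
Qed.

(** The truncations of the logarithm and of the exponential are independent here, since their limits
    are taken one after the other. *)
Lemma coef_expp_clog w x D M m : (m <= M)%N -> (m <= D)%N ->
  (expp (clog w x D) M)`_m = cpoly m w x.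
Proof.
move=> mM mD; rewrite -(expp_coef w x mM) /expp !coef_sum; apply: eq_bigr => l _.
rewrite !coefZ; congr (_ * _); apply: coef_exp_trunc => r rm.
by rewrite !clog_coef// (leq_trans rm).
Qed.

(** The i-th coefficient of [clog] has degree at most [i.+1] in [j], and the indices of the [l]
    factors add up to [m]; the slack of [nsizeM] turns [l] into [l.*2]. *)
Lemma nsize_clogX w D l m : nsize (fun j => (clog w j%:R D ^+ l)`_m) (m + l.*2).+1.
Proof.
elim: l m => [|l IH] m.
  have -> : (fun j => (clog w j%:R D ^+ 0)`_m) = fun=> (m == 0%N)%:R.
    by apply/funext => j; rewrite expr0 coef1.
  by apply: (@nsizeW _ _ 1) => //; exact: nsize_cst.
have -> : (fun j => (clog w j%:R D ^+ l.+1)`_m) =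
    fun j => \sum_(i < m.+1) (clog w j%:R D)`_i * (clog w j%:R D ^+ l)`_(m - i).
  by apply/funext => j; rewrite exprS coefM.
apply: nsize_sum => i.
have im : (i <= m)%N by rewrite -ltnS.
have -> : ((m + l.+1.*2).+1 = i.+2 + (m - i + l.*2).+1)%N.
  by rewrite doubleS !addSn !addnS addnA subnKC.
apply: nsizeM => //.
have [iD|iD] := ltnP i D.+1; last first.
  have -> : (fun j => (clog w j%:R D)`_i) = fun=> 0.
    by apply/funext => j; rewrite coef_poly ltnNge iD.
  by move=> r _; rewrite ncoef_cst0.
have -> : (fun j => (clog w j%:R D)`_i) =
    fun j => - (w / i.+1%:R) * (j%:R ^+ i.+1 + -1 * j%:R).
  apply/funext => j; rewrite coef_poly iD exprS; field.
  by rewrite nat1r pnatr_eq0.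
apply: nsizeZ; apply: nsizeD; first exact: nsize_natX.
by apply: nsizeZ; apply: (@nsizeW _ _ 2) => //; exact: nsize_nat.
Qed.

(** Differences of order above 3N therefore see nothing of c_0, ..., c_N. The bound is [nsize_clogX]
    with [l <= m]. *)
Lemma nsize_cpoly w m : nsize (fun j => cpoly m w j%:R) (3 * m).+1.
Proof.
have -> : (fun j => cpoly m w j%:R) = fun j =>
    \sum_(l < m.+1) l`!%:R^-1 * (clog w j%:R m ^+ l)`_m.
  by apply/funext => j; rewrite /cpoly coef_sum; apply: eq_bigr => l _; rewrite coefZ.
apply: nsize_sum => l; apply: nsizeZ.
apply: nsizeW (@nsize_clogX w m l m).
by rewrite ltnS mulSn leq_add2l mul2n leq_double -ltnS.
Qed.

(* The factor [A ^- N.+1] comes from evaluating the majorant at [A * t]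
   instead of [t]: all omitted monomials have degree at least [N.+1]. *)
Lemma ncoef_expp_clog_le w t A N M D r q :
  0 <= w -> 0 <= t -> 1 <= A -> (N <= M)%N -> (N <= D)%N -> (r <= q)%N ->
  'C(q, r)%:R * `|ncoef (fun j => (expp (clog w j%:R D) M).[t]
      - \sum_(0 <= m < N.+1) cpoly m w j%:R * t ^+ m) r|
    <= A ^- N.+1 * (expp (- clog w q%:R D) M).[A * t].
Proof.
move=> w0 t0 A1 NM ND rq; have A0 : 0 < A by rewrite (lt_le_trans ltr01).
(* [Z] exceeds both [N] and the degree of every exponential sum below, so that all of them are
   summed over one range. *)
pose Z := (N + D * M).+1.
have EZ (p : {poly R}) x : (size p <= D.+1)%N ->
    (expp p M).[x] = \sum_(0 <= m < Z) (expp p M)`_m * x ^+ m.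
  move=> sp; rewrite big_mkord; apply: horner_coef_wide.
  rewrite (leq_trans (size_expp _ _))// ltnS (leq_trans _ (leq_addl _ _))//.
  by rewrite leq_mul2r -ltnS (leq_trans (leqSpred _))// ?sp ?orbT//; case: (size p) sp.
have sc x : (size (clog w x D) <= D.+1)%N by exact: size_poly.
have mj s := @maj_expp _ _ M s (fun s => maj_clog D s w0).
have NZ : (N.+1 <= Z)%N by rewrite ltnS leq_addr.
(* Up to degree [N] the coefficients are the c_m themselves and cancel. *)
rewrite (eq_ncoef (g := fun j => \sum_(N.+1 <= m < Z) t ^+ m * (expp (clog w j%:R D) M)`_m)); last first.
  move=> j; rewrite EZ// (@big_cat_nat _ _ _ N.+1 0 Z)//=.
  rewrite [X in X + _ - _](eq_big_nat _ _ (F2 := fun m => cpoly m w j%:R * t ^+ m)).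
    by rewrite addrAC subrr add0r; apply: eq_bigr => m _; rewrite mulrC.
  by move=> m /andP[_ mN]; rewrite coef_expp_clog// (leq_trans _ NM, leq_trans _ ND)// -ltnS.
rewrite EZ ?size_polyN// ler_pdivlMl ?exprn_gt0//.
rewrite ncoef_sum mulrCA.
(* For [m > N] the factor [A ^+ N.+1] is at most [A ^+ m]; the terms [m <= N] are added back, being
   nonnegative for the majorant. *)
apply: (@le_trans _ _ ('C(q, r)%:R * \sum_(0 <= m < Z)
   (A * t) ^+ m * ncoef (fun j => (expp (- clog w j%:R D) M)`_m) r)).
  rewrite ler_wpM2l//; apply: (le_trans (ler_wpM2l _ (ler_norm_sum _ _ _))).
    by rewrite exprn_ge0// ltW.
  rewrite [leRHS](@big_cat_nat _ _ _ N.+1 0 Z)//= mulr_sumr -[leLHS]add0r.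
  apply: lerD.
    apply: sumr_ge0 => m _; rewrite mulr_ge0 ?exprn_ge0 ?mulr_ge0 ?(ltW A0)//.
    exact: le_trans (mj m r).
  rewrite [leLHS]big_nat [leRHS]big_nat; apply: ler_sum => m /andP[Nm _].
  rewrite ncoefZ normrM ger0_norm ?exprn_ge0// mulrA exprMn.
  apply: ler_pM => //.
  - by rewrite mulr_ge0 ?exprn_ge0// ltW.
  - by rewrite ler_wpM2r ?exprn_ge0// ler_weXn2l.
  - exact: (mj m r).
rewrite mulr_sumr; apply: ler_sum => m _; rewrite mulrCA mulrC.
rewrite ler_wpM2r ?exprn_ge0 ?mulr_ge0 ?(ltW A0)//.
(* A single Newton term of the majorant is at most its value at [q]. *)
apply: (ncoef_le (f := fun j => (expp (- clog w j%:R D) M)`_m)) => // i.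
by rewrite ger0_norm// (le_trans _ (mj m i)).
Qed.

(** For s >= 1 the denominator s + 1 is at least 2 and (xy)^s <= xy 2^(1-s), so the series is at
    most w x (xy) times the sum of the 2^-s. *)
Lemma clogN_horner w x y D : 0 <= w -> 1 <= x -> 0 <= y -> x * y <= 2^-1 ->
  0 <= (- clog w x D).[y] <= w * x ^+ 2 * y.
Proof.
move=> w0 x1 y0 xy; have x0 : 0 <= x by rewrite (le_trans ler01).
have xy0 : 0 <= x * y by rewrite mulr_ge0.
rewrite hornerN horner_poly -sumrN; apply/andP; split.
  apply: sumr_ge0 => s _; rewrite mulNr opprK mulr_ge0 ?exprn_ge0// divr_ge0//.
  by rewrite !mulr_ge0// subr_ge0 exprn_ege1.
have -> : w * x ^+ 2 * y = w * x * (x * y) * 1 by rewrite expr2; ring.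
apply: (@le_trans _ _ (w * x * (x * y) * \sum_(s < D.+1) (if s == 0%N :> nat then 0 else 2^-1 ^+ s))); last first.
  by rewrite ler_wpM2l ?sum_half// !mulr_ge0.
rewrite mulr_sumr; apply: ler_sum => s _; rewrite mulNr opprK.
case: eqP => [->|/eqP]; first by rewrite expr0 subrr !(mulr0, mul0r).
case: (nat_of_ord s) => // {}s _.
rewrite -!mulrA ler_wpM2l// ler_wpM2l// !mulrA.
apply: (@le_trans _ _ (x ^+ s.+1 * 2^-1 * y ^+ s.+1)).
  rewrite ler_wpM2r ?exprn_ge0//; apply: ler_pM => //.
  - by rewrite subr_ge0 exprn_ege1.
  - by rewrite gerBl.
  by rewrite lef_pV2 ?posrE ?ltr0n// ler_nat.
rewrite mulrAC -exprMn !exprS -!mulrA ler_wpM2l// ler_wpM2l//.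
by rewrite mulrC ler_wpM2l ?invr_ge0// lerXn2r// nnegrE invr_ge0.
Qed.

Lemma cvg_ln_series x : `|x| <= 2^-1 ->
  (\sum_(i < D.+1) x ^+ i.+1 / i.+1%:R @[D --> \oo] --> - ln (1 - x))%classic.
Proof.
move=> x2; rewrite -[X in (_ --> X)%classic]add0r.
pose d D := \sum_(i < D.+1) x ^+ i.+1 / i.+1%:R.
suff H : (ln (1 - x) + d D @[D --> \oo] --> (0 : R))%classic.
  have -> : (fun D => \sum_(i < D.+1) x ^+ i.+1 / i.+1%:R) =
      fun D => (ln (1 - x) + d D) + - ln (1 - x).
    by apply/funext => D; rewrite addrAC subrr add0r.
  by apply: cvgD => //; exact: cvg_cst.
apply/norm_cvg0P.
apply: (@squeeze_cvgr _ _ _ _ (fun=> 0) (fun D => (2 * `|x| ^+ 2) * `|x| ^+ D)).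
- apply: nearW => D; rewrite normr_ge0 /= (le_trans (ln_taylor D.+1 x2))//.
  by rewrite -mulrA -exprD.
- exact: cvg_cst.
- by apply: cvg_geometric; rewrite normr_id; lra.
Qed.

Lemma cvg_clog_horner w t x : t != 0 -> `|x * t| <= 2^-1 -> `|t| <= 2^-1 ->
  ((clog w x D).[t] @[D --> \oo] --> w / t * (ln (1 - x * t) - x * ln (1 - t)))%classic.
Proof.
move=> t0 xt t2.
have -> : (fun D => (clog w x D).[t]) = fun D => - (w / t) *
    (\sum_(i < D.+1) (x * t) ^+ i.+1 / i.+1%:R - x * \sum_(i < D.+1) t ^+ i.+1 / i.+1%:R).
  apply/funext => D; rewrite horner_poly mulr_sumr -sumrB mulr_sumr; apply: eq_bigr => i _.
  by rewrite exprMn !exprS; field; rewrite t0 andbT nat1r pnatr_eq0.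
have -> : w / t * (ln (1 - x * t) - x * ln (1 - t)) =
    - (w / t) * (- ln (1 - x * t) - x * - ln (1 - t)) by ring.
apply: cvgMr; apply: cvgB; first exact: cvg_ln_series.
by apply: cvgMr; exact: cvg_ln_series.
Qed.

(** The bound for the truncated series does not depend on [M] and [D]. Letting [M] tend to infinity
    turns [expp] into [expR], then [D] produces the logarithms; pointwise convergence suffices
    because a difference involves finitely many points. *)
Lemma ncoef_remainder_le w t A N r q :
  0 <= w -> 0 < t -> t <= 2^-1 -> 1 <= A -> (0 < q)%N -> (r <= q)%N ->
  q%:R * (A * t) <= 2^-1 ->
  'C(q, r)%:R * `|ncoef (fun j => expR (w / t * (ln (1 - j%:R * t) - j%:R * ln (1 - t)))
      - \sum_(0 <= m < N.+1) cpoly m w j%:R * t ^+ m) r|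
    <= A ^- N.+1 * expR (w * q%:R ^+ 2 * (A * t)).
Proof.
move=> w0 t0 t2 A1 q0 rq qAt.
have A0 : 0 < A by rewrite (lt_le_trans ltr01).
have tN0 : t != 0 by rewrite gt_eqF.
pose c j := \sum_(0 <= m < N.+1) cpoly m w j%:R * t ^+ m.
have bnd D M : (N <= M)%N -> (N <= D)%N ->
    'C(q, r)%:R * `|ncoef (fun j => (expp (clog w j%:R D) M).[t] - c j) r|
    <= A ^- N.+1 * expR (w * q%:R ^+ 2 * (A * t)).
  move=> NM ND; apply: (le_trans (ncoef_expp_clog_le w0 (ltW t0) A1 NM ND rq)).
  rewrite ler_wpM2l ?invr_ge0 ?exprn_ge0 ?(ltW A0)// expp_horner.
  have /andP[h0 h1] := @clogN_horner w q%:R (A * t) D w0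
    (ltac:(by rewrite ler1n)) (mulr_ge0 (ltW A0) (ltW t0)) qAt.
  by apply: (le_trans (sum_exp_coeff_le _ h0)); rewrite ler_expR.
have bndD D : (N <= D)%N ->
    'C(q, r)%:R * `|ncoef (fun j => expR (clog w j%:R D).[t] - c j) r|
    <= A ^- N.+1 * expR (w * q%:R ^+ 2 * (A * t)).
  move=> ND.
  have H : ('C(q, r)%:R * `|ncoef (fun j => (expp (clog w j%:R D) M).[t] - c j) r|
      @[M --> \oo] --> 'C(q, r)%:R * `|ncoef (fun j => expR (clog w j%:R D).[t] - c j) r|)%classic.
    apply: cvgMr; apply: cvg_norm.
    apply: (@cvg_ncoef _ (fun M j => (expp (clog w j%:R D) M).[t] - c j)) => j _.
    apply: cvgB; last exact: cvg_cst.
    set z := (clog w j%:R D).[t].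
    have -> : (fun M => (expp (clog w j%:R D) M).[t]) = fun M => series (exp_coeff z) M.+1.
      by apply/funext => M; rewrite expp_horner /series /= big_mkord.
    by rewrite (cvg_shiftS (series (exp_coeff z))); exact: is_cvg_series_exp_coeff.
  apply: (cvgr_to_le H); exists N => // M /= NM; exact: bnd.
have H : ('C(q, r)%:R * `|ncoef (fun j => expR (clog w j%:R D).[t] - c j) r|
    @[D --> \oo] --> 'C(q, r)%:R * `|ncoef (fun j =>
      expR (w / t * (ln (1 - j%:R * t) - j%:R * ln (1 - t))) - c j) r|)%classic.
  apply: cvgMr; apply: cvg_norm.
  apply: (@cvg_ncoef _ (fun D j => expR (clog w j%:R D).[t] - c j)) => j jr.
  apply: cvgB; last exact: cvg_cst.
  apply: (@cvg_comp _ _ _ (fun D => (clog w j%:R D).[t]) expR); last exact: continuous_expR.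
  apply: cvg_clog_horner => //; last by rewrite gtr0_norm.
  rewrite normrM normr_nat gtr0_norm// (le_trans _ qAt)//.
  apply: ler_pM => //; [exact: ltW|by rewrite ler_nat (leq_trans jr)|].
  by rewrite ler_peMl// ltW.
apply: (cvgr_to_le H); exists N => // D /= ND; exact: bndD.
Qed.

End ExponentialCoefficients.

Lemma ffact_le_expn b r : (b ^_ r <= b ^ r)%N.
Proof.
by elim: r => // r IH; rewrite ffactnSr expnSr leq_mul// leq_subr.
Qed.

Lemma expn_le_ffact a b r : (a + r <= b)%N -> (a ^ r <= b ^_ r)%N.
Proof.
elim: r => // r IH ab; rewrite ffactnSr expnSr leq_mul ?IH//; lia.
Qed.

Lemma bernoulli_le (R : realDomainType) (x : R) j : x <= 1 -> 1 - j%:R * x <= (1 - x) ^+ j.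
Proof.
move=> x1; elim: j => [|j IH]; first by rewrite mul0r subr0.
rewrite exprS; apply: (le_trans _ (ler_wpM2l _ IH)); last by rewrite subr_ge0.
rewrite -natr1 -subr_ge0.
have -> : (1 - x) * (1 - j%:R * x) - (1 - (j%:R + 1) * x) = j%:R * (x * x) by ring.
by rewrite mulr_ge0// -expr2 sqr_ge0.
Qed.

(** * The remainder *)

Section Remainder.
Variable R : realType.
Variables (n k : nat).
Hypothesis (n0 : (0 < n)%N) (k1 : (1 < k)%N).

Let q : R := (1 - k%:R^-1) ^+ n.
Let F (j : nat) : R := (1 - j%:R / k%:R) ^+ n / q ^+ j.
Let mu : R := k%:R * (q / (1 - q)).

Let k0 : 0 < k%:R :> R. Proof. by rewrite ltr0n ltnW. Qed.
Let kV_lt1 : k%:R^-1 < 1 :> R. Proof. by rewrite invf_lt1// ltr1n. Qed.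

Let q0 : 0 < q. Proof. by rewrite exprn_gt0// subr_gt0. Qed.
Let q1 : q < 1.
Proof. by rewrite exprn_ilt1 -?lt0n// ?subr_ge0 ?(ltW kV_lt1)// gtrBl invr_gt0. Qed.

(** Bernoulli's inequality 1 - j/k <= (1 - 1/k)^j, raised to the power [n]. *)
Let F_norm_le1 j : (j <= k)%N -> `|F j| <= 1.
Proof.
move=> jk; have jk1 : 0 <= 1 - j%:R / k%:R :> R.
  by rewrite subr_ge0 ler_pdivrMr// mul1r ler_nat.
rewrite /F ger0_norm; last by apply: divr_ge0; rewrite exprn_ge0// ltW.
have qj : 0 < q ^+ j by apply: exprn_gt0.
rewrite ler_pdivrMr// mul1r /q exprAC lerXn2r// ?nnegrE//.
  by rewrite exprn_ge0// subr_ge0 ltW.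
by apply: bernoulli_le; rewrite ltW.
Qed.

(** The strict inequality keeps 1 - j/k positive, so that its logarithm is meaningful. *)
Let F_expR j : (j < k)%N -> F j =
  expR (n%:R / k%:R / k%:R^-1 * (ln (1 - j%:R * k%:R^-1) - j%:R * ln (1 - k%:R^-1))).
Proof.
move=> jk; rewrite invrK divfK ?gt_eqF// mulrBr expRB.
have X (x : R) i : 0 < x -> expR (i%:R * ln x) = x ^+ i.
  by move=> x0; rewrite expRM_natl lnK.
rewrite X; last by rewrite subr_gt0 ltr_pdivrMr// mul1r ltr_nat.
by rewrite mulrA -natrM X ?subr_gt0// exprM.
Qed.

Let powbin_le r : 'C(k, r)%:R * (q / (1 - q)) ^+ r <= mu ^+ r / r`!%:R.
Proof.
rewrite /mu [(k%:R * _) ^+ r]exprMn mulrAC ler_wpM2r ?exprn_ge0//.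
  by rewrite divr_ge0 ?(ltW q0)// subr_ge0 ltW.
rewrite ler_pdivlMr ?ltr0n ?fact_gt0// -natrM bin_ffact -natrX ler_nat.
exact: ffact_le_expn.
Qed.

Lemma remainder_le N L (A : R) : (0 < L)%N -> (2 * L < k)%N -> (3 * N <= L)%N ->
  1 <= A -> (2 * L)%:R * (A / k%:R) <= 2^-1 ->
  `| Snk R n k
       - \sum_(0 <= j < k.+1)
           (-1) ^+ j * 'C(k, j)%:R * (1 - k%:R^-1) ^+ (n * j)
           * \sum_(0 <= m < N.+1) cpoly m (n%:R / k%:R) j%:R / k%:R ^+ m |
  <= (1 - q) ^+ k *
     (A ^- N.+1 * expR (n%:R / k%:R * (2 * L)%:R ^+ 2 * (A / k%:R)) *
        \sum_(0 <= r < L.+1) (mu / L%:R) ^+ r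
      + \sum_(L.+1 <= r < k.+1) (2 * mu) ^+ r / r`!%:R).
Proof.
move=> L0 Lk NL A1 LA.
have p0 : 0 <= q / (1 - q) by rewrite divr_ge0 ?(ltW q0)// subr_ge0 ltW.
have mu0 : 0 <= mu by rewrite mulr_ge0.
pose c j : R := \sum_(0 <= m < N.+1) cpoly m (n%:R / k%:R) j%:R * k%:R^-1 ^+ m.
pose G j := F j - c j.
rewrite (_ : _ - _ = \sum_(j < k.+1) 'C(k, j)%:R * (- q) ^+ j * G j); last first.
  rewrite SnkE 1?ltnW// big_mkord -sumrB; apply: eq_bigr => j _.
  rewrite /G /F /c exprM -/q [(- q) ^+ j]exprNn.
  under eq_bigr do rewrite -exprVn.
  by field; rewrite expf_neq0// gt_eqF.
rewrite binomial_transform.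
(* The cancellation now sits in the factor (1 - q)^(k-r), and absolute values can be taken term by
   term. *)
apply: (le_trans (ler_norm_sum _ _ _)).
rewrite -(big_mkord xpredT (fun r => `|'C(k, r)%:R * (- q) ^+ r * (1 - q) ^+ (k - r) * ncoef G r|)).
have E r : (r <= k)%N -> `|'C(k, r)%:R * (- q) ^+ r * (1 - q) ^+ (k - r) * ncoef G r|
   = (1 - q) ^+ k * ('C(k, r)%:R * (q / (1 - q)) ^+ r * `|ncoef G r|).
  move=> rk; rewrite !normrM normr_nat normrX normrN (gtr0_norm q0).
  rewrite [`|(1 - q) ^+ _|]ger0_norm ?exprn_ge0 ?subr_ge0 ?(ltW q1)//.
  have -> : (1 - q) ^+ k = (1 - q) ^+ (k - r) * (1 - q) ^+ r by rewrite -exprD subnK.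
  rewrite expr_div_n; field.
  by rewrite expf_neq0// gt_eqF// subr_gt0.
rewrite (@eq_big_nat _ _ _ _ _ _ (fun r => (1 - q) ^+ k *
    ('C(k, r)%:R * (q / (1 - q)) ^+ r * `|ncoef G r|))); last first.
  by move=> r /andP[_ rk]; rewrite E.
rewrite -mulr_sumr ler_wpM2l ?exprn_ge0 ?subr_ge0 ?(ltW q1)//.
rewrite (@big_cat_nat _ _ _ L.+1 0 k.+1)//=; last by lia.
apply: lerD; last first.
  rewrite [leLHS]big_nat [leRHS]big_nat; apply: ler_sum => r /andP[Lr rk].
  rewrite [(2 * mu) ^+ r]exprMn -[leRHS]mulrA [leRHS]mulrC; apply: ler_pM => //.
  - by rewrite mulr_ge0// exprn_ge0.
  (* As [r] exceeds [L], hence 3N, the c_m contribute nothing and the crude bound 2^r for [F]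
     remains. *)
  - have -> : ncoef G r = ncoef F r.
      rewrite /G (ncoefD F (fun j => - c j)) ncoefN /c ncoef_sum big_nat big1 ?subr0// => m /andP[_ mN].
      rewrite (eq_ncoef (g := fun j => k%:R^-1 ^+ m * cpoly m (n%:R / k%:R) j%:R)).
        by rewrite ncoefZ nsize_cpoly ?mulr0//; lia.
      by move=> j; rewrite mulrC.
    rewrite -[leRHS]mulr1; apply: ncoef_bound => j jr; apply: F_norm_le1; lia.
rewrite mulr_sumr [leLHS]big_nat [leRHS]big_nat; apply: ler_sum => r /andP[_ rL].
set B := A ^- N.+1 * _.
have B0 : 0 <= B by rewrite mulr_ge0 ?expR_ge0// invr_ge0 exprn_ge0// (le_trans ler01).
have GB : 'C(2 * L, r)%:R * `|ncoef G r| <= B.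
  rewrite (@ncoef_local _ G (fun j => expR (n%:R / k%:R / k%:R^-1 * (ln (1 - j%:R * k%:R^-1)
     - j%:R * ln (1 - k%:R^-1))) - c j)); last first.
    by move=> j jr; rewrite /G F_expR//; lia.
  apply: ncoef_remainder_le => //.
  - by rewrite invr_gt0.
  - by rewrite lef_pV2 ?posrE// ler_nat.
  - lia.
  - lia.
(* For [r <= L] each factor of the falling factorial of 2L is at least [L]; this trades mu^r / r!
   for (mu / L)^r. *)
have LC : L%:R ^+ r <= 'C(2 * L, r)%:R * r`!%:R :> R.
  by rewrite -natrM bin_ffact -natrX ler_nat expn_le_ffact//; lia.
have L0' : 0 < L%:R ^+ r :> R by rewrite exprn_gt0// ltr0n.
apply: (le_trans (ler_wpM2r _ (powbin_le r))) => //.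
rewrite expr_div_n mulrA ler_pdivlMr// mulrAC.
apply: (@le_trans _ _ (mu ^+ r / r`!%:R * ('C(2 * L, r)%:R * r`!%:R) * `|ncoef G r|)).
  by rewrite ler_wpM2r// ler_wpM2l// divr_ge0// exprn_ge0.
have -> : mu ^+ r / r`!%:R * ('C(2 * L, r)%:R * r`!%:R) * `|ncoef G r|
   = mu ^+ r * ('C(2 * L, r)%:R * `|ncoef G r|).
  by field; rewrite pnatr_eq0 -lt0n fact_gt0.
by rewrite mulrC ler_wpM2r// exprn_ge0.
Qed.

End Remainder.

(** * Elementary real inequalities *)

Section RealBounds.
Variable R : realType.
Implicit Types (x y : R) (m : nat).

Lemma expr_le_fact_expR x m : 0 <= x -> x ^+ m <= m`!%:R * expR x.
Proof.
move=> x0; case: m => [|m].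
  by rewrite mul1r expr0 (le_trans _ (expR_ge1Dx x))// lerDl.
have := expR_ge1Dxn m x0; rewrite -ler_pdivrMl ?ltr0n ?fact_gt0// mulrC.
by apply: le_trans; rewrite lerDr.
Qed.

Lemma exprD_le x y m : 0 <= x -> 0 <= y ->
  (x + y) ^+ m <= 2 ^+ m * (x ^+ m + y ^+ m).
Proof.
move=> x0 y0; wlog xy : x y x0 y0 / x <= y.
  by move=> H; have [/H->//|/ltW yx] := leP x y; rewrite addrC [_ ^+ m + _]addrC H.
apply: (@le_trans _ _ ((2 * y) ^+ m)).
  by rewrite lerXn2r ?nnegrE ?addr_ge0// ?mulr_ge0//; lra.
by rewrite exprMn ler_wpM2l ?exprn_ge0// lerDr exprn_ge0.
Qed.

(* Weighting the terms by [e ^ (r - m) >= 1], as in Chernoff's bound. *)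
Lemma exp_series_tail_le x m p : 0 <= x ->
  \sum_(m.+1 <= r < p) x ^+ r / r`!%:R <= expR (expR 1 * x - m%:R).
Proof.
move=> x0; rewrite expRD mulrC expRN ler_pdivlMl ?expR_gt0//.
have ex0 : 0 <= expR 1 * x by rewrite mulr_ge0 ?expR_ge0.
have [mp|mp] := leqP m.+1 p; last first.
  by rewrite big_geq ?mulr0 ?expR_ge0// ltnW.
apply: (le_trans _ (sum_exp_coeff_le p ex0)).
rewrite -(big_mkord xpredT (fun l => (expR 1 * x) ^+ l / l`!%:R)).
rewrite (@big_cat_nat _ _ _ m.+1 0 p)//= -[leLHS]add0r; apply: lerD.
  by apply: sumr_ge0 => l _; rewrite divr_ge0// exprn_ge0.
rewrite mulr_sumr [leLHS]big_nat [leRHS]big_nat; apply: ler_sum => r /andP[mr _].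
rewrite mulrA ler_wpM2r ?invr_ge0// exprMn ler_wpM2r ?exprn_ge0//.
by rewrite -expRM_natl mulr1 ler_expR ler_nat ltnW.
Qed.

Lemma geometric_half_sum x m : 0 <= x -> x <= 2^-1 -> \sum_(0 <= r < m) x ^+ r <= 2.
Proof.
move=> x0 x2; have H : (1 - x) * \sum_(0 <= r < m) x ^+ r <= 1.
  by rewrite big_mkord -opprB mulNr -subrX1 opprB gerBl exprn_ge0.
have S0 : 0 <= \sum_(0 <= r < m) x ^+ r by apply: sumr_ge0 => r _; exact: exprn_ge0.
by nra.
Qed.

End RealBounds.

(** * Asymptotics *)

Section Asymptotics.
Variable R : realType.
Variables (n k : nat).
Variables x s rho lam q : R.
Local Notation eta := (lam * x / s).
Hypotheses (xE : x = ln n%:R) (sE' : s = Num.sqrt n%:R) (rhoE : rho = n%:R / k%:R).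
Hypotheses (lamE : lam = k%:R * expR (- rho)) (qE : q = (1 - k%:R^-1) ^+ n).
Hypotheses (n0 : (0 < n)%N) (k0 : (0 < k)%N) (x1 : 1 <= x).
Hypotheses (h1 : n%:R / x <= k%:R) (h2 : k%:R <= 2 * n%:R / (x + 6)).

Let nR : (0 : R) < n%:R. Proof. by rewrite ltr0n. Qed.
Let kR : (0 : R) < k%:R. Proof. by rewrite ltr0n. Qed.
Let x0 : 0 < x. Proof. exact: lt_le_trans x1. Qed.

Let ss : s * s = n%:R.
Proof. by rewrite sE' -expr2 sqr_sqrtr// ltW. Qed.

Let s0 : 0 < s. Proof. by rewrite sE' sqrtr_gt0. Qed.

Let sE : s = expR (x / 2).
Proof.
apply/eqP; rewrite -(eqrXn2 (n := 2)) ?expR_ge0// ?ltW//.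
by rewrite !expr2 ss -expRD -splitr xE lnK.
Qed.

Let rho_le : rho <= x.
Proof. by move: h1; rewrite rhoE ler_pdivrMr// ler_pdivrMr// mulrC. Qed.

(** The 6 in the upper bound on [k] becomes the 3 here, which makes [expR (- rho)] at most 1/(4 sqrt
    n). *)
Let rho_ge : x / 2 + 3 <= rho.
Proof.
have x6 : 0 < x + 6 by have := x1; lra.
by move: h2; rewrite rhoE !ler_pdivlMr//; lra.
Qed.

Let lam_k : lam / k%:R = expR (- rho).
Proof. by rewrite lamE mulrC mulKf ?gt_eqF. Qed.

Let lam0 : 0 < lam. Proof. by rewrite lamE mulr_gt0 ?expR_gt0. Qed.

(** The lower bound on [k] enters twice: directly, and through [rho <= x], which gives
    [expR (- rho)] at least 1/n. *)
Let lamx : 1 <= lam * x.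
Proof.
have : n%:R^-1 <= expR (- rho) by rewrite -[n%:R in leLHS]lnK ?posrE// -xE -expRN ler_expR lerN2.
move=> H; apply: (@le_trans _ _ (k%:R * n%:R^-1 * x)).
  rewrite mulrAC ler_pdivlMr// mul1r.
  by move: h1; rewrite ler_pdivrMr.
by rewrite lamE; apply: ler_wpM2r; [exact: ltW|apply: ler_wpM2l => //; exact: ltW].
Qed.

Let exp3 : expR (- 3) <= (4^-1 : R).
Proof.
rewrite expRN lef_pV2 ?posrE ?expR_gt0//.
by apply: (le_trans _ (expR_ge1Dx 3)); lra.
Qed.

Let exprho : expR (- rho) <= 4^-1 / s.
Proof.
apply: (@le_trans _ _ (expR (- 3 - x / 2))); first by rewrite ler_expR; have := rho_ge; lra.
by rewrite expRD expRN -sE ler_wpM2r// invr_ge0 ltW.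
Qed.

Let s1 : 1 <= s.
Proof. by rewrite sE (le_trans _ (expR_ge1Dx _))// lerDl divr_ge0// ltW. Qed.

Let exprho4 : expR (- rho) <= 4^-1.
Proof. by apply: (le_trans exprho); rewrite ler_piMr// invf_le1. Qed.

Let eta_le1 : eta <= 1.
Proof.
rewrite ler_pdivrMr// mul1r lamE.
have x6 : 0 < x + 6 by have := x1; lra.
have H : k%:R * x <= 2 * (s * s).
  move: h2; rewrite ss ler_pdivlMr//; apply: le_trans.
  by rewrite ler_wpM2l ?(ltW kR)//; lra.
apply: (@le_trans _ _ (k%:R * x * (4^-1 / s))).
  by rewrite mulrAC ler_wpM2l// ltW// mulr_gt0.
apply: (@le_trans _ _ (2 * (s * s) * (4^-1 / s))).
  by rewrite ler_wpM2r// divr_ge0// ltW.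
have -> : 2 * (s * s) * (4^-1 / s) = 2^-1 * s by field; rewrite gt_eqF.
by rewrite ler_piMl ?ltW//; lra.
Qed.

(** Lets errors that are powers of 1/sqrt n be absorbed into powers of [eta]. *)
Let s_eta : s^-1 <= eta.
Proof. by apply: ler_peMl => //; rewrite invr_ge0 ltW. Qed.

Let q_le : q <= expR (- rho).
Proof.
have -> : - rho = n%:R * - k%:R^-1 by rewrite mulrN rhoE.
rewrite qE expRM_natl lerXn2r ?nnegrE ?expR_ge0//.
  by rewrite subr_ge0 invf_le1// ler1n.
exact: expR_ge1Dx.
Qed.

(** With e = [expR (- rho)] one has q >= e (1 - 2 rho / k). As rho e <= 1 and e <= 1/4, this gives 1
    - q <= (1 - e) (1 + 4/k), and the k-th power costs a factor e^4 at most. *)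
Lemma pow_1Bq_le : (1 < k)%N -> (1 - q) ^+ k <= expR 4 * (1 - lam / k%:R) ^+ k.
Proof.
move=> k1; rewrite lam_k.
have kV : k%:R^-1 <= 2^-1 :> R by rewrite lef_pV2 ?posrE// ler_nat.
have kV0 : 0 < k%:R^-1 :> R by rewrite invr_gt0.
have ln1 : - k%:R^-1 - 2 * k%:R^-1 ^+ 2 <= ln (1 - k%:R^-1) :> R.
  have := @ln_taylor R k%:R^-1 1; rewrite gtr0_norm// => /(_ kV).
  by rewrite big_ord1 expr1 divr1 ler_norml => /andP[H _]; lra.
have qge : expR (- rho) * (1 - 2 * rho / k%:R) <= q.
  apply: (@le_trans _ _ (expR (- rho - 2 * rho / k%:R))).
    by rewrite expRD ler_wpM2l ?expR_ge0// expR_ge1Dx.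
  rewrite qE -[X in _ <= X ^+ _]lnK ?posrE ?subr_gt0; last by lra.
  rewrite -expRM_natl ler_expR.
  have -> : - rho - 2 * rho / k%:R = n%:R * (- k%:R^-1 - 2 * k%:R^-1 ^+ 2).
    by rewrite rhoE; field; rewrite gt_eqF.
  by rewrite ler_wpM2l.
have rhoe : rho * expR (- rho) <= 1.
  rewrite expRN ler_pdivrMr ?expR_gt0// mul1r.
  by apply: (le_trans _ (expR_ge1Dx _)); rewrite lerDr.
have q1 : q <= 1 by by have := q_le; have := exprho4; lra.
have e1 : 0 <= 1 - expR (- rho) by have := exprho4; lra.
apply: (@le_trans _ _ (((1 - expR (- rho)) * expR (4 / k%:R)) ^+ k)).
  rewrite lerXn2r ?nnegrE ?subr_ge0// ?mulr_ge0 ?expR_ge0//.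
  apply: (@le_trans _ _ ((1 - expR (- rho)) * (1 + 4 / k%:R))); last first.
    by rewrite ler_wpM2l// expR_ge1Dx.
  have H : 2 * (rho * expR (- rho)) * k%:R^-1 <= (1 - expR (- rho)) * 4 * k%:R^-1.
    by rewrite ler_wpM2r ?(ltW kV0)//; have := exprho4; lra.
  by move: qge H; rewrite -!mulrA; set e := expR _; set v := k%:R^-1; nra.
rewrite exprMn -expRM_natl mulrC ler_wpM2r ?exprn_ge0//.
by rewrite mulrC mulfVK ?gt_eqF.
Qed.

Let mu_le : k%:R * (q / (1 - q)) <= 2 * lam.
Proof.
have q4 : q <= 4^-1 by exact: le_trans q_le exprho4.
have qq : 0 < 1 - q by lra.
rewrite lamE [leRHS]mulrCA ler_wpM2l ?(ltW kR)// ler_pdivrMr//.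
have := expR_gt0 (- rho); have := q_le; nra.
Qed.


Let x_sqr : x ^+ 2 <= 8 * s.
Proof.
have x2 : 0 <= x / 2 by rewrite divr_ge0// ltW.
have := expr_le_fact_expR 2 x2.
rewrite -sE [2`!%:R](_ : _ = 2 :> R)// expr_div_n ler_pdivrMr; last by rewrite exprn_gt0.
by rewrite (_ : 2 ^+ 2 = 4 :> R); [lra|rewrite expr2; lra].
Qed.

Let x_over_k : x / k%:R <= 8 / s.
Proof.
rewrite ler_pdivrMr// mulrAC ler_pdivlMr//.
have H : s * s <= k%:R * x by move: h1; rewrite ss ler_pdivrMr.
have := x_sqr; rewrite expr2 => xs; have := s0; have := x0.
move=> X S.
rewrite -(ler_pM2r X) -(ler_pM2r S).
have := ler_wpM2r (ltW S) xs.
have : 8 * (s * s) * s <= 8 * (k%:R * x) * s.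
  by rewrite ler_wpM2r ?(ltW S)// ler_wpM2l.
nra.
Qed.

(** In the constant, [expR 4] comes from [pow_1Bq_le], the 2 from the geometric sum, and the final 1
    from the tail [r > L]. *)
Lemma remainder_le_large N : let K := 4 * expR 1 + (3 * N)%:R + 8 in
  144 * K <= s ->
  `| Snk R n k
       - \sum_(0 <= j < k.+1)
           (-1) ^+ j * 'C(k, j)%:R * (1 - k%:R^-1) ^+ (n * j)
           * \sum_(0 <= m < N.+1) cpoly m (n%:R / k%:R) j%:R / k%:R ^+ m |
    <= expR 4 * (2 * expR (2080 * K ^+ 2 + 4) * (16 * K ^+ 2) ^+ N.+1
          * (1 + 2 ^+ (4 * N.+1) * (4 * N.+1)`!%:R) + 1)
       * ((1 - lam / k%:R) ^+ k * eta ^+ (2 * N + 1)).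
Proof.
(* The summand [4 * expR 1] of [K] beats the tail exponent, 3N ensures [3 * N <= L], and 8 gives
   [8 * lam <= L], hence a geometric ratio below 1/2. *)
move=> K Ks.
have K8 : 8 <= K by have := expR_ge0 (1 : R); have := ler0n R (3 * N); rewrite /K; lra.
have KN : (3 * N)%:R <= K by have := expR_ge0 (1 : R); rewrite /K; lra.
have Ke : 4 * expR 1 <= K by have := ler0n R (3 * N); rewrite /K; lra.
have K0 : 0 <= K by lra.
clearbody K; have N2 : (2 * N.+1 = (2 * N + 1).+1)%N by rewrite mulnS addnC addnS.
have X0 := x0; have X1 := x1; have S0 := s0; have S1 := s1.
have L0 := lam0; have N0 := nR; have KR0 := kR.
(* The logarithm in [y] keeps the tail [r > L] below [n ^- N.+1] when [lam]
   is small; the half power of [n] between [eta ^+ 2N+2] and [eta ^+ 2N+1]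
   pays for it. *)
pose y := K * (lam + x).
have y8 : 8 <= y by rewrite /y; nra.
have yx : K * x <= y by rewrite /y; nra.
have ylam : K * lam <= y by rewrite /y; nra.
pose L := (Num.truncn y).+1.
have /andP[trL ltrL] : (Num.truncn y)%:R <= y < L%:R.
  by apply: truncn_itv; lra.
have Ly : L%:R <= 2 * y by rewrite /L -natr1; lra.
clearbody L.
(* Since lam / k <= 1/(4s) and x / k <= 8/s, 2y / k is at most 18 K / s; the hypothesis with 144 =
   18 * 8 brings it below 1/8. *)
have LK : L%:R / k%:R <= 8^-1 :> R.
  have e4 := exprho; rewrite -lam_k in e4.
  apply: (@le_trans _ _ (2 * y / k%:R)); first by rewrite ler_wpM2r// invr_ge0 ltW.
  apply: (@le_trans _ _ (2 * K * (9 / s))).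
    rewrite /y mulrA -[leLHS]mulrA ler_wpM2l ?mulr_ge0// mulrDl.
    have := x_over_k; have : 0 < s^-1 by rewrite invr_gt0.
    lra.
  by rewrite mulrA ler_pdivrMr//; lra.
have Lk : (8 * L <= k)%N.
  by rewrite -(ler_nat R) natrM; move: LK; rewrite ler_pdivrMr//; lra.
have Lg0 : (0 < L)%N by rewrite -(ltr_nat R); lra.
have LR0 : 0 < L%:R :> R by rewrite ltr0n.
have [k1 L2k] : (1 < k)%N /\ (2 * L < k)%N by clear -Lk Lg0; lia.
have rho3 : 3 <= rho by have := rho_ge; lra.
have rho0 : 0 <= rho by exact: le_trans rho3.
have y0 : 0 <= y by exact: le_trans y8.
(* With A = 1 + 1/a the exponent in [remainder_le] is 4aA = 4a + 4, bounded along with [a], while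
   A^-(N+1) <= a^(N+1). *)
pose a := rho * L%:R ^+ 2 / k%:R.
have a0 : 0 < a by rewrite /a !mulr_gt0 ?invr_gt0 ?exprn_gt0//; lra.
pose A := 1 + a^-1.
have A1 : 1 <= A by rewrite lerDl invr_ge0 ltW.
have LA : (2 * L)%:R * (A / k%:R) <= 2^-1.
  have -> : (2 * L)%:R * (A / k%:R) = 2 * (L%:R / k%:R) + 2 / (rho * L%:R).
    rewrite natrM /A /a; field.
    by rewrite !gt_eqF//; lra.
  have : 2 / (rho * L%:R) <= 4^-1.
    rewrite ler_pdivrMr; last by rewrite mulr_gt0//; lra.
    have : 3 * 8 <= rho * L%:R by apply: ler_pM => //; lra.
    lra.
  lra.
have NL : (3 * N <= L)%N.
  rewrite -(ler_nat R); apply: (le_trans KN).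
  have : K <= K * x by rewrite ler_peMr.
  lra.
have := remainder_le n0 k1 Lg0 L2k NL A1 LA.
rewrite -rhoE -qE => /le_trans; apply.
have q0 : 0 <= q by rewrite qE exprn_ge0// subr_ge0 invf_le1// ler1n.
have q4 : q <= 4^-1 by have := q_le; have := exprho4; lra.
have eta0 : 0 <= eta by rewrite !mulr_ge0 ?invr_ge0// ltW.
have etaS m : s^-1 ^+ m <= eta ^+ m.
  by rewrite lerXn2r ?nnegrE ?invr_ge0 ?(ltW S0)//; exact: s_eta.
pose mu := k%:R * (q / (1 - q)).
have mu0 : 0 <= mu by rewrite /mu !mulr_ge0 ?invr_ge0//; lra.
have mu2 : mu <= 2 * lam by exact: mu_le.
rewrite -/mu; clearbody mu.
have lamL : 8 * lam <= L%:R.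
  by have : 8 * lam <= K * lam by [rewrite ler_wpM2r// ltW]; lra.
have geo : \sum_(0 <= r < L.+1) (mu / L%:R) ^+ r <= 2.
  by apply: geometric_half_sum; rewrite ?divr_ge0// ler_pdivrMr//; lra.
have tail : \sum_(L.+1 <= r < k.+1) (2 * mu) ^+ r / r`!%:R <= eta ^+ (2 * N + 1).
  have mu20 : 0 <= 2 * mu by rewrite mulr_ge0.
  apply: (le_trans (exp_series_tail_le L k.+1 mu20)).
  apply: (@le_trans _ _ (s^-1 ^+ (2 * N.+1))).
    rewrite exprM (_ : s^-1 ^+ 2 = expR (- x)); last first.
      by rewrite expr2 -invfM ss expRN xE lnK.
    rewrite -expRM_natl ler_expR mulrN.
    have KN1 : N.+1%:R <= K.
      by move: KN; rewrite natrM -natr1; have := ler0n R N; lra.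
    have : N.+1%:R * x <= K * x by rewrite ler_wpM2r// ltW.
    have : expR 1 * (2 * mu) <= 4 * expR 1 * lam.
      by have := ler_wpM2l (expR_ge0 (1 : R)) mu2; lra.
    have : 4 * expR 1 * lam <= K * lam by rewrite ler_wpM2r// ltW.
    by move: ltrL; rewrite /y; lra.
  apply: (le_trans _ (etaS _)); rewrite N2 exprS.
  by rewrite ler_piMl ?exprn_ge0 ?invr_ge0 ?invf_le1// ltW.
pose eps := x ^+ 4 / n%:R.
have eps0 : 0 <= eps by rewrite divr_ge0// exprn_ge0// ltW.
have eps64 : eps <= 64.
  rewrite ler_pdivrMr// -ss (_ : 64 * (s * s) = (8 * s) ^+ 2); last by ring.
  rewrite [x ^+ 4](exprM x 2 2) lerXn2r ?nnegrE ?sqr_ge0 ?mulr_ge0 ?(ltW S0)//.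
(* Since a = (rho L)^2 / n, this follows from rho <= x, L <= 2y and (lam + x)^2 <= 2 (lam^2 +
   x^2). *)
have ae : a <= 8 * K ^+ 2 * (eta ^+ 2 + eps).
  have -> : a = (rho * L%:R) ^+ 2 / n%:R by rewrite /a rhoE; field; rewrite !gt_eqF.
  have -> : 8 * K ^+ 2 * (eta ^+ 2 + eps) = 8 * K ^+ 2 * x ^+ 2 * (lam ^+ 2 + x ^+ 2) / n%:R.
    by rewrite /eps -ss; field; rewrite gt_eqF.
  rewrite ler_wpM2r ?invr_ge0 ?(ltW N0)//.
  apply: (@le_trans _ _ ((x * (2 * y)) ^+ 2)).
    rewrite lerXn2r ?nnegrE//; [exact: mulr_ge0| |exact: ler_pM].
    by apply: mulr_ge0; [exact: ltW|exact: mulr_ge0].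
  rewrite /y.
  have -> : (x * (2 * (K * (lam + x)))) ^+ 2 = 4 * K ^+ 2 * x ^+ 2 * (lam + x) ^+ 2 by ring.
  have -> : 8 * K ^+ 2 * x ^+ 2 * (lam ^+ 2 + x ^+ 2) = 4 * K ^+ 2 * x ^+ 2 * (2 * (lam ^+ 2 + x ^+ 2)) by ring.
  apply: ler_wpM2l; first by rewrite !mulr_ge0 ?exprn_ge0// ltW.
  rewrite -subr_ge0 (_ : _ - _ = (lam - x) ^+ 2) ?sqr_ge0//; ring.
have eta1 : eta ^+ 2 <= 1 by apply: exprn_ile1 => //; exact: eta_le1.
have a520 : a <= 520 * K ^+ 2.
  apply: (le_trans ae).
  have -> : 520 * K ^+ 2 = 8 * K ^+ 2 * (1 + 64) by ring.
  by rewrite ler_wpM2l ?mulr_ge0 ?exprn_ge0// lerD.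
have expo : expR (rho * (2 * L)%:R ^+ 2 * (A / k%:R)) <= expR (2080 * K ^+ 2 + 4).
  rewrite ler_expR.
  have -> : rho * (2 * L)%:R ^+ 2 * (A / k%:R) = 4 * (a * A).
    by rewrite natrM /a; ring.
  have -> : a * A = a + 1 by rewrite /A mulrDr mulr1 divff// gt_eqF.
  by lra.
have Aa : A ^- N.+1 <= (16 * K ^+ 2) ^+ N.+1 * (1 + 2 ^+ (4 * N.+1) * (4 * N.+1)`!%:R) * eta ^+ (2 * N + 1).
  apply: (@le_trans _ _ (a ^+ N.+1)).
    rewrite -exprVn lerXn2r ?nnegrE ?invr_ge0 ?(le_trans ler01 A1) ?(ltW a0)//.
    rewrite /A invf_ple ?posrE// ?ltr_pwDl ?invr_ge0 ?(ltW a0)//.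
    by rewrite lerDr.
  apply: (@le_trans _ _ ((8 * K ^+ 2 * (eta ^+ 2 + eps)) ^+ N.+1)).
    by rewrite lerXn2r ?nnegrE ?(ltW a0) ?mulr_ge0 ?exprn_ge0 ?addr_ge0 ?exprn_ge0.
  rewrite exprMn (_ : 16 * K ^+ 2 = 8 * K ^+ 2 * 2); last by ring.
  rewrite [(8 * K ^+ 2 * 2) ^+ _]exprMn -[leRHS]mulrA -[leRHS]mulrA ler_wpM2l ?exprn_ge0 ?mulr_ge0 ?exprn_ge0//.
  apply: (le_trans (exprD_le N.+1 (exprn_ge0 2 eta0) eps0)).
  rewrite ler_wpM2l ?exprn_ge0// mulrDl mul1r; apply: lerD.
    by rewrite -exprM N2 exprS ler_piMl ?exprn_ge0//.
  (* Up to a constant, x^(4N+4) is at most one factor [s = expR (x / 2)], which leaves 2N + 1 of the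
     2N + 2 powers of 1/s; then [s^-1 <= eta]. *)
  apply: (@le_trans _ _ (2 ^+ (4 * N.+1) * (4 * N.+1)`!%:R * s^-1 ^+ (2 * N + 1))); last first.
    by rewrite ler_wpM2l// mulr_ge0// exprn_ge0.
  rewrite /eps expr_div_n -exprM ler_pdivrMr ?exprn_gt0//.
  have -> : n%:R ^+ N.+1 = s * s ^+ (2 * N + 1).
    by rewrite -ss -expr2 -exprM N2 exprS.
  have -> : 2 ^+ (4 * N.+1) * (4 * N.+1)`!%:R * s^-1 ^+ (2 * N + 1) * (s * s ^+ (2 * N + 1))
     = 2 ^+ (4 * N.+1) * ((4 * N.+1)`!%:R * s).
    by rewrite exprVn; field; rewrite expf_neq0// gt_eqF.
  have x2 : 0 <= x / 2 by rewrite divr_ge0// ltW.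
  have := expr_le_fact_expR (4 * N.+1) x2; rewrite -sE expr_div_n.
  by rewrite ler_pdivrMr ?exprn_gt0// mulrC.
have P := pow_1Bq_le k1.
rewrite [leRHS](_ : _ = expR 4 * (1 - lam / k%:R) ^+ k *
   ((2 * expR (2080 * K ^+ 2 + 4) * (16 * K ^+ 2) ^+ N.+1
          * (1 + 2 ^+ (4 * N.+1) * (4 * N.+1)`!%:R) + 1) * eta ^+ (2 * N + 1))); last by ring.
have A0 : 0 <= A ^- N.+1 by rewrite invr_ge0 exprn_ge0// (le_trans ler01).
have geo0 : 0 <= \sum_(0 <= r < L.+1) (mu / L%:R) ^+ r.
  by apply: sumr_ge0 => r _; rewrite exprn_ge0// divr_ge0.
have tail0 : 0 <= \sum_(L.+1 <= r < k.+1) (2 * mu) ^+ r / r`!%:R.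
  by apply: sumr_ge0 => r _; rewrite divr_ge0// exprn_ge0// mulr_ge0.
apply: ler_pM => //.
- by rewrite exprn_ge0//; lra.
- by rewrite addr_ge0 ?mulr_ge0 ?expR_ge0.
rewrite [leRHS]mulrDl mul1r; apply: lerD => //.
set B := (16 * K ^+ 2) ^+ N.+1 * _ * _ in Aa.
apply: (@le_trans _ _ (B * expR (2080 * K ^+ 2 + 4) * 2)).
  by apply: ler_pM => //; [rewrite mulr_ge0 ?expR_ge0|apply: ler_pM; rewrite ?expR_ge0].
by rewrite le_eqVlt; apply/orP; left; apply/eqP; rewrite /B; ring.
Qed.

End Asymptotics.

(** * Small n and the uniform constant *)

(** Only finitely many pairs have [n < n0], because [k <= n]; the sum of all their ratios
    [f n k / g n k] is added to the constant. *)
Lemma uniform_bound (R : realType) (P : nat -> nat -> Prop) (f g : nat -> nat -> R)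
    (C0 : R) (n0 : nat) :
  (forall n k, P n k -> (k <= n)%N) ->
  (forall n k, P n k -> 0 <= f n k /\ 0 < g n k) ->
  (forall n k, P n k -> (n0 <= n)%N -> f n k <= C0 * g n k) ->
  exists C : R, forall n k, P n k -> f n k <= C * g n k.
Proof.
move=> kn fg large.
exists (`|C0| + \sum_(n < n0) \sum_(k < n0) `|f n k / g n k|) => n k Pnk.
have [f0 g0] := fg _ _ Pnk.
have [nn0|nn0] := leqP n0 n.
  apply: (le_trans (large _ _ Pnk nn0)); rewrite ler_pM2r//.
  apply: (le_trans (ler_norm _)); rewrite lerDl.
  by apply: sumr_ge0 => i _; apply: sumr_ge0.
rewrite -ler_pdivrMr//.
have kn0 : (k < n0)%N by exact: leq_ltn_trans (kn _ _ Pnk) nn0.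
rewrite (bigD1 (Ordinal nn0))//= (bigD1 (Ordinal kn0))//=.
apply: (le_trans (ler_norm _)); rewrite addrCA -addrA lerDl.
apply: addr_ge0; first exact: sumr_ge0.
by apply: addr_ge0 => //; apply: sumr_ge0 => i _; apply: sumr_ge0.
Qed.

Theorem theorem5 (R : realType) (N : nat) :
  exists C : R, forall n k : nat, (0 < n)%N -> (0 < k)%N ->
    n%:R / ln n%:R <= k%:R :> R ->
    k%:R <= 2 * n%:R / (ln n%:R + 6) :> R ->
    `| Snk R n k
       - \sum_(0 <= j < k.+1)
           (-1) ^+ j * 'C(k, j)%:R * (1 - k%:R^-1) ^+ (n * j)
           * \sum_(0 <= m < N.+1) cpoly m (n%:R / k%:R) j%:R / k%:R ^+ m |
    <= C * ((1 - lambda R n k / k%:R) ^+ k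
            * (lambda R n k * ln n%:R / Num.sqrt n%:R) ^+ (2 * N + 1)).
Proof.
pose P (n k : nat) := [/\ (0 < n)%N, (0 < k)%N, n%:R / ln n%:R <= k%:R :> R &
    k%:R <= 2 * n%:R / (ln n%:R + 6) :> R].
pose K : R := 4 * expR 1 + (3 * N)%:R + 8.
have K0 : 0 <= K by have := expR_ge0 (1 : R); have := ler0n R (3 * N); rewrite /K; lra.
(* Above this threshold sqrt n >= 144 K and ln n >= 1. *)
pose y := (144 * K) ^+ 2 + expR 1.
suff [C HC] : exists C : R, forall n k, P n k ->
   `| Snk R n k
       - \sum_(0 <= j < k.+1)
           (-1) ^+ j * 'C(k, j)%:R * (1 - k%:R^-1) ^+ (n * j)
           * \sum_(0 <= m < N.+1) cpoly m (n%:R / k%:R) j%:R / k%:R ^+ m |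
    <= C * ((1 - lambda R n k / k%:R) ^+ k
            * (lambda R n k * ln n%:R / Num.sqrt n%:R) ^+ (2 * N + 1)).
  by exists C => n k n0 k0 h1 h2; apply: HC.
apply: (@uniform_bound _ P _ _ _ (Num.truncn y).+1).
- move=> n k [n0 k0 h1 h2]; have nR : 0 < n%:R :> R by rewrite ltr0n.
  rewrite -(ler_nat R); apply: (le_trans h2).
  have l0 : 0 <= ln n%:R :> R by rewrite ln_ge0// ler1n.
  rewrite ler_pdivrMr; last by lra.
  by rewrite mulrC ler_wpM2l//; lra.
- move=> n k [n0 k0 h1 h2]; split=> //.
  have nR : 0 < n%:R :> R by rewrite ltr0n.
  have kR : 0 < k%:R :> R by rewrite ltr0n.
  have ln0 : 0 < ln n%:R :> R.
    (* [n = 1] is excluded by the upper bound on [k], which is then 1/3; the quotient by [ln 1 = 0]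
       is 0 there. *)
    have : (1 < n)%N.
      rewrite ltn_neqAle n0 andbT; apply/eqP => n1.
      move: h2; rewrite -n1 ln1 add0r mulr1 => h2.
      have : 1 <= k%:R :> R by rewrite ler1n.
      by lra.
    by rewrite -(ltr1n R) => n1; exact: ln_gt0.
  rewrite mulr_gt0// exprn_gt0//.
    rewrite subr_gt0 /lambda mulrC mulKf ?gt_eqF// expR_lt1 oppr_lt0.
    by rewrite divr_gt0.
  by rewrite divr_gt0 ?sqrtr_gt0// mulr_gt0// mulr_gt0// expR_gt0.
move=> n k [n0 k0 h1 h2] yn.
have nR : 0 < n%:R :> R by rewrite ltr0n.
have y0 : 0 <= y by rewrite addr_ge0 ?sqr_ge0 ?expR_ge0.
have {}yn : y <= n%:R.
  have /andP[_ /ltW] := truncn_itv y0; move/le_trans; apply.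
  by rewrite ler_nat.
apply: (remainder_le_large erefl erefl erefl erefl erefl) => //.
  rewrite -ler_expR lnK ?posrE//; apply: le_trans yn.
  by rewrite lerDr sqr_ge0.
rewrite -/K -[leLHS]ger0_norm ?mulr_ge0// -sqrtr_sqr ler_sqrt//.
by apply: le_trans yn; rewrite lerDl expR_ge0.
Qed.
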